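(* Let $G$ be a finite group. If $G$ is not supersolvable, then $\alpha(G)\le\alpha(S_4)$, with equality if and only if $G\cong {C_2}^n\times S_4$ for some non-negative integer $n$.
   Context: For a finite group $H$, $c(H)$ denotes the number of cyclic subgroups of $H$ (including the trivial one) and $\alpha(H):=c(H)/|H|$. $S_4$ is the symmetric group of degree $4$, $C_2$ is the cyclic group of order $2$, and ${C_2}^n$ is the direct product of $n$ copies of $C_2$. *)

(* Defs.v *)
From mathcomp Require Export all_boot all_order all_algebra all_fingroup all_solvable.

Set Implicit Arguments.
Unset Strict Implicit.
Unset Printing Implicit Defensive.

Import Order.TTheory GRing.Theory Num.Theory.
Local Open Scope ring_scope.

(* The groups are values of type {group gT}, so each subgroup is counted once,
   independently of how many generators it has. *)
Definition num_cyclic (gT : finGroupType) (G : {group gT}) : nat :=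
  #|[set H in subgroups G | cyclic H]|.

Definition alpha (gT : finGroupType) (G : {group gT}) : rat :=
  (num_cyclic G)%:R / #|G|%:R.

(* A step H <= K of a series all of whose terms are normal in the whole group
   G, not merely in the next term: that is what separates supersolvable groups
   from solvable ones. *)
Definition cyclic_normal_step (gT : finGroupType) (G : {group gT}) :
    rel {group gT} :=
  fun H K => [&& H <| G, K <| G, H \subset K & cyclic (K / H)]%g.

Definition supersolvable (gT : finGroupType) (G : {group gT}) : Prop :=
  exists2 s : seq {group gT},
    path (cyclic_normal_step G) 1%G s & last 1%G s = G.

(* 'Z_2 is regarded as an additive group; {dffun forall _ : 'I_n, 'Z_2}
   carries the external direct product structure with pointwise operations. *)
Definition C2pow (n : nat) : finGroupType := {dffun forall _ : 'I_n, 'Z_2}.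

(* Main.v *)
Require Import Defs.
From mathcomp Require Import all_field all_character zify ring.

(** Let I(G) be the number of elements x of G with x^2 = 1. A cyclic group of
    order at least 3 has at least two generators, so 2 c(G) <= |G| + I(G), with
    equality when the totients of all element orders are at most 2
    ([num_cyclic_le], [num_cyclic_eq]). Equality holds for C_2^n x S_4, and
    I(S_4) = 10, so that alpha(S_4) = 17/24. The theorem therefore follows from a
    statement about I ([nonsupersolvable_sqrt1]): a group that is not
    supersolvable satisfies I(G) < 5/12 |G| or has a quotient G / N isomorphic to
    S_4; in the latter case I(G) <= |N| I(S_4) = 5/12 |G|, because square roots of
    1 remain so modulo N.

    For the same reason this statement passes from a quotient to the group, so
    all proper quotients of G may be assumed supersolvable. Let M be a minimal
    normal subgroup; it is not cyclic. If a coset xM contains a square root of 1,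
    which may be taken to be x, then it contains as many of them as x inverts
    elements of M. Averaging over the cosets gives I(G), and there are three
    cases.

    If M is not abelian and a coset of M contains J square roots of 1, then
    J^2 <= k |M|, where k is the number of classes of M. But M is perfect and
    without irreducible characters of degree 2, so 9 k <= |M| + 8 and
    J < 5/12 |M| ([nonabelian_sqrt1_coset]).

    If |M| is odd, the elements inverted by x form a subgroup, which is M or has
    index at least 3. If I(G) >= 5/12 |G|, almost everything must come from
    elements acting on M as 1 or -1, and then M cannot be both minimal and
    noncyclic ([odd_minnormal_sqrt1]).

    If M is a 2-group with centralizer C, a coset of C other than C itself
    contains at most |C| / 2 square roots of 1, and only if it squares to C. So
    G / C has many square roots of 1; it is supersolvable and has no normal
    subgroup of order 2, which forces it to have order 6. All the estimates are
    then equalities, C = M has order 4, |G| = 24, and G acts faithfully on its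
    four Sylow 3-subgroups ([two_minnormal_order24],
    [selfcentralizing4_isog_S4]).

    Finally, alpha(G) = alpha(S_4) forces I(G) = |N| I(G / N) with G / N
    isomorphic to S_4. Every lift of a square root of 1 is then a square root of
    1, which makes N central of exponent 2 and complemented
    ([S4_extension_split]). *)

Set Implicit Arguments.
Unset Strict Implicit.
Unset Printing Implicit Defensive.

Import Order.TTheory GRing.Theory Num.Theory.
Local Open Scope ring_scope.

(** * Square roots of 1 and cyclic subgroups *)

Section Involutions.
Local Open Scope group_scope.
Local Open Scope nat_scope.

Implicit Types gT rT : finGroupType.

Definition sqrt1 gT (A : {set gT}) : {set gT} := [set x in A | x ^+ 2 == 1]%g.

Lemma sqrt1P gT (A : {set gT}) x :
  reflect (x \in A /\ (x ^+ 2 = 1)%g) (x \in sqrt1 A).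
Proof.
by rewrite inE; apply: (iffP andP) => [[-> /eqP] | [-> ->]].
Qed.

Lemma injm_sqrt1 gT rT (G : {group gT}) (f : {morphism G >-> rT}) :
  'injm f -> #|sqrt1 (f @* G)%g| = #|sqrt1 G|.
Proof.
move=> injf; have sSG: sqrt1 G \subset G by apply/subsetP=> x /sqrt1P[].
rewrite -(card_injm injf sSG); apply: eq_card => y.
apply/sqrt1P/morphimP => [[/morphimP[x Gx _ ->]] | [x Gx /sqrt1P[_ x2] ->]].
  rewrite -morphX // => fx2; exists x => //; apply/sqrt1P; split=> //.
  by apply: (injmP injf); rewrite ?groupX ?morph1.
by rewrite mem_morphim // -morphX // x2 morph1.
Qed.

Lemma isog_sqrt1 gT rT (G : {group gT}) (H : {group rT}) :
  G \isog H -> #|sqrt1 H| = #|sqrt1 G|.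
Proof. by case/isogP=> f injf <-; apply: injm_sqrt1. Qed.

Lemma sqrt1_invg gT (x : gT) : (x ^+ 2 = 1 -> x^-1 = x)%g.
Proof. by rewrite expgS expg1 => xx; apply/eqP; rewrite eq_invg_mul xx. Qed.

Lemma sqrt1_commute gT (G : {set gT}) x y :
  x \in sqrt1 G -> y \in sqrt1 G -> (x * y \in sqrt1 G -> commute x y)%g.
Proof.
move=> /sqrt1P[_ x2] /sqrt1P[_ y2] /sqrt1P[_ xy2].
by rewrite /commute -{1}(sqrt1_invg xy2) invMg !sqrt1_invg.
Qed.

(** If u and uy square to 1, then uy is its own inverse, that is
    uy = y^-1 u; so the square roots of 1 in a coset act by inversion on the
    quotient of any two of them. *)
Lemma sqrt1_mul_conj (gT : finGroupType) (u y : gT) :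
  (u ^+ 2 = 1 -> (u * y) ^+ 2 = 1 -> y ^ u = y^-1)%g.
Proof.
move=> /sqrt1_invg uV /sqrt1_invg; rewrite invMg uV => yV.
by rewrite conjgE uV mulgA -yV -mulgA -{1}uV mulVg mulg1.
Qed.

Lemma order_sqrt1 gT (x : gT) : (#[x]%g <= 2) = (x ^+ 2 == 1)%g.
Proof.
rewrite -order_dvdn; apply/idP/idP => [|/dvdn_leq->//].
by have := order_gt0 x; case: #[x]%g => [|[|[|]]].
Qed.

Definition cyclic_subgroups gT (G : {group gT}) : {set {group gT}} :=
  [set H in subgroups G | cyclic H].

Definition gens gT (H : {group gT}) : {set gT} := [set x | generator H x].

(** The generator sets of the cyclic subgroups partition the group, so
    anything inside it can be counted subgroup by subgroup. *)
Lemma sum_gens gT (G : {group gT}) (A : {set gT}) :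
  A \subset G -> \sum_(H in cyclic_subgroups G) #|A :&: gens H| = #|A|.
Proof.
move=> /subsetP sAG; rewrite -sum1_card.
rewrite (partition_big (fun x : gT => <[x]>%G) (mem (cyclic_subgroups G))) /=.
  apply: eq_bigr => H _; rewrite -sum1_card; apply: eq_bigl => x.
  by rewrite !inE /generator -val_eqE eq_sym.
by move=> x Ax; rewrite !inE cycle_cyclic cycle_subG sAG.
Qed.

Lemma card_gens_cycle gT (x : gT) : #|gens <[x]>| = totient #[x]%g.
Proof. by rewrite totient_gen. Qed.

Lemma gens_cycle_sqrt1 gT (G : {group gT}) (x : gT) : x \in G ->
  #|sqrt1 G :&: gens <[x]>| = (#[x]%g <= 2) * #|gens <[x]>|.
Proof.
move=> Gx; have ord y: y \in gens <[x]> -> #[y]%g = #[x]%g /\ y \in G.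
  rewrite inE => /eqP def_x; rewrite !orderE -def_x; split=> //.
  by rewrite -cycle_subG -def_x cycle_subG.
case: (leqP #[x]%g 2) => ox /=; rewrite ?mul1n ?mul0n.
  apply: eq_card => y; rewrite inE; case gy: (y \in gens _); rewrite ?andbF //.
  by have [oy Gy] := ord y gy; rewrite inE Gy -order_sqrt1 oy ox.
apply: eq_card0 => y; rewrite inE; apply/negP => /andP[/sqrt1P[_ /eqP]].
by rewrite -order_sqrt1 => oy /ord[oyx _]; rewrite oyx leqNgt ox in oy.
Qed.

(** A cyclic group of order at least 3 has the two generators x and x^-1;
    below that order the only generator is a square root of 1 and is counted
    twice. Equality holds exactly when the totient of the order is at most 2. *)
Lemma gens_cycle_ge2 gT (G : {group gT}) (x : gT) : x \in G ->
  2 <= #|gens <[x]>| + #|sqrt1 G :&: gens <[x]>|.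
Proof.
move=> Gx; rewrite gens_cycle_sqrt1 //; case: (leqP #[x]%g 2) => ox /=.
  by rewrite mul1n addnn (leq_double 1) card_gens_cycle totient_gt0 order_gt0.
rewrite mul0n addn0; have <- : #|[set x; x^-1%g]| = 2.
  rewrite cards2 -[x == _]eq_sym eq_invg_mul -(expgS x 1) -order_sqrt1.
  by rewrite leqNgt ox.
apply: subset_leq_card; apply/subsetP => y /set2P[] ->;
  by rewrite inE /generator ?cycleV.
Qed.

Lemma sum_gens_sqrt1 gT (G : {group gT}) :
  \sum_(H in cyclic_subgroups G) (#|gens H| + #|sqrt1 G :&: gens H|)
    = #|G| + #|sqrt1 G|.
Proof.
have sIG: sqrt1 G \subset G by apply/subsetP=> x /sqrt1P[].
rewrite -(sum_gens sIG) -[in RHS](sum_gens (subxx G)) -big_split /=.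
apply: eq_bigr => H; rewrite !inE => /andP[sHG _]; congr (_ + _).
apply: eq_card => x; rewrite !inE andbC; apply/esym/andb_idr => /eqP defH.
by rewrite -cycle_subG -defH.
Qed.

(** This reduces bounds on the number of cyclic subgroups to bounds on the
    number of square roots of 1. *)
Lemma num_cyclic_le gT (G : {group gT}) :
  (num_cyclic G).*2 <= #|G| + #|sqrt1 G|.
Proof.
rewrite -sum_gens_sqrt1 -muln2 -sum_nat_const; apply: leq_sum => H.
rewrite !inE => /andP[sHG /cyclicP[x defH]].
have -> : H = <[x]>%G by apply: val_inj.
by apply: gens_cycle_ge2; rewrite -cycle_subG -defH.
Qed.

Lemma num_cyclic_eq gT (G : {group gT}) :
  {in G, forall x, totient #[x]%g <= 2} ->
  (num_cyclic G).*2 = #|G| + #|sqrt1 G|.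
Proof.
move=> le2; apply/eqP; rewrite eqn_leq num_cyclic_le -sum_gens_sqrt1.
rewrite -muln2 -sum_nat_const; apply: leq_sum => H.
rewrite !inE => /andP[sHG /cyclicP[x defH]].
have Gx : x \in G by rewrite -cycle_subG -defH.
have -> : H = <[x]>%G by apply: val_inj.
rewrite gens_cycle_sqrt1 // card_gens_cycle.
case: (leqP #[x]%g 2) => [ox|_] /=; last by rewrite addn0 le2.
by case: #[x]%g ox => [|[|[|]]].
Qed.

Definition coset_sqrt1 gT (G M : {set gT}) (x : gT) : {set gT} :=
  [set m in M | (x * m)%g \in sqrt1 G].

Lemma coset_sqrt1P gT (G M : {set gT}) x m :
  reflect [/\ m \in M, (x * m)%g \in G & ((x * m) ^+ 2 = 1)%g]
          (m \in coset_sqrt1 G M x).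
Proof.
by rewrite inE; apply: (iffP andP) => [[-> /sqrt1P[]] | [-> *]];
  split=> //; apply/sqrt1P.
Qed.

(** Each square root of 1 is met once for every m in M, as x = (x m) m^-1.
    Summing over all elements instead of coset representatives avoids the
    choice of a transversal; all the bounds on the number of square roots of 1
    below come from bounding the terms of this sum one by one. *)
Lemma sum_sqrt1_coset gT (G M : {group gT}) : M \subset G ->
  \sum_(x in G) #|coset_sqrt1 G M x| = #|M| * #|sqrt1 G|.
Proof.
move=> sMG; rewrite -sum_nat_const.
under eq_bigr => x _ do rewrite -sum1_card.
rewrite (exchange_big_dep (mem M)) /=; last first.
  by move=> x m _ /coset_sqrt1P[].
apply: eq_bigr => m Mm; have Gm := subsetP sMG m Mm.
rewrite sum1_card -(card_rcoset (sqrt1 G) m^-1); apply: eq_card => x.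
rewrite mem_rcoset invgK unfold_in /= inE Mm /=.
apply: andb_idl => /sqrt1P[]; by rewrite groupMr.
Qed.

Lemma card_preim_quotient gT (G N : {group gT}) (A : {set coset_of N}) :
  N <| G -> A \subset (G / N)%g ->
  #|[set x in G | coset N x \in A]| = #|N| * #|A|.
Proof.
move=> nsNG /subsetP sAQ; have nNG := subsetP (normal_norm nsNG).
rewrite -sum1_card (partition_big (coset N) (mem A)) /=; last first.
  by move=> x; rewrite inE => /andP[].
rewrite mulnC -sum_nat_const; apply: eq_bigr => y Ay.
have /morphimP[x0 Nx0 Gx0 def_y] := sAQ y Ay.
rewrite sum1_card -(card_rcoset N x0); apply: eq_card => x.
rewrite unfold_in /= inE; apply/idP/rcosetP => [/andP[/andP[Gx _] /eqP]|[n Nn ->]].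
  rewrite def_y => /(rcoset_kercosetP (nNG _ Gx) Nx0) /rcosetP[n Nn ->].
  by exists n.
have Nn' := subsetP (normG N) n Nn.
have coset_nx0 : coset N (n * x0)%g = y.
  by rewrite morphM //= coset_id // mul1g.
by rewrite coset_nx0 Ay eqxx groupM // (subsetP (normal_sub nsNG)).
Qed.

(** Square roots of 1 stay square roots of 1 modulo N. Equality forces the
    whole preimage of the square roots of 1 of the quotient to square to 1,
    which determines the extension in the extremal case. *)
Lemma sqrt1_quotient gT (G N : {group gT}) : N <| G ->
  #|sqrt1 G| <= #|N| * #|sqrt1 (G / N)%g| ?= iff
     [forall x in G, (coset N x \in sqrt1 (G / N)%g) ==> (x ^+ 2 == 1)%g].
Proof.
move=> nsNG; have nNG := normal_norm nsNG.
have sIQ: sqrt1 (G / N)%g \subset (G / N)%g by apply/subsetP=> x /sqrt1P[].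
rewrite -(card_preim_quotient nsNG sIQ).
have sub: sqrt1 G \subset [set x in G | coset N x \in sqrt1 (G / N)%g].
  apply/subsetP=> x /sqrt1P[Gx x2]; rewrite inE Gx; apply/sqrt1P; split.
    by rewrite mem_quotient.
  by rewrite -morphX ?(subsetP nNG) // x2 morph1.
have [le_card eq_card] := subset_leqif_cards sub; split=> //; rewrite {}eq_card.
apply/eqP/forall_inP => [eqI x Gx | all2].
  apply/implyP => Ix; have: x \in sqrt1 G by rewrite eqI inE Gx.
  by case/sqrt1P => _ ->.
apply/eqP; rewrite eqEsubset sub; apply/subsetP=> x; rewrite inE => /andP[Gx Ix].
by apply/sqrt1P; split=> //; apply/eqP/(implyP (all2 x Gx)).
Qed.

End Involutions.

(** * Supersolvable groups *)

Section Supersolvable.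
Local Open Scope group_scope.

Implicit Types gT : finGroupType.

(** Reachability in a finite graph is decidable, so a normal subgroup whose
    quotient is not supersolvable can be searched for. *)
Lemma supersolvableP gT (G : {group gT}) :
  reflect (supersolvable G) (connect (cyclic_normal_step G) 1%G G).
Proof.
by apply: (iffP connectP) => [[s ps def_G] | [s ps def_G]]; exists s.
Qed.

Lemma supersolvable_trivial gT (G : {group gT}) :
  G :=: 1 -> supersolvable G.
Proof. by move=> G1; exists [::] => //=; apply: val_inj. Qed.

(** The preimage of a cyclic normal series of the quotient starts at N,
    and the step from 1 to N is cyclic by assumption. *)
Lemma supersolvable_by_cyclic gT (G N : {group gT}) :
  N <| G -> cyclic N -> supersolvable (G / N) -> supersolvable G.
Proof.
move=> nsNG cycN [s ps def_GN]; apply/supersolvableP.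
have nNG := normal_norm nsNG; have sNG := normal_sub nsNG.
pose pre (K : {group coset_of N}) := (coset N @*^-1 K)%G.
have pre_step H K : cyclic_normal_step (G / N) H K ->
    cyclic_normal_step G (pre H) (pre K).
  case/and4P=> nsH nsK sHK cycKH.
  have nspre (L : {group coset_of N}) : L <| G / N -> pre L <| G.
    by move=> nsL; rewrite -(quotientGK nsNG) cosetpre_normal.
  apply/and4P; split; rewrite ?nspre ?morphpreS //.
  have nsNH : N <| pre H.
    by rewrite /normal sub_cosetpre subsetIl.
  have nsHK : pre H <| pre K.
    by apply: normalS (morphpreS _ sHK) (normal_sub (nspre _ nsK)) (nspre _ nsH).
  have nsNK := normalS (sub_cosetpre K) (normal_sub (nspre _ nsK)) nsNG.
  have := third_isog (normal_sub nsNH) nsNK nsHK.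
  by rewrite !cosetpreK => /isog_cyclic <-.
have step1 : connect (cyclic_normal_step G) 1%G (pre 1%G).
  apply: connect1; have -> : pre 1%G = N by apply: val_inj; apply: ker_coset.
  by apply/and4P; split; rewrite ?normal1 ?sub1G ?quotient_cyclic.
have {2}-> : G = pre (G / N)%G by apply: val_inj; rewrite /= quotientGK.
rewrite -def_GN; apply: connect_trans step1 _.
elim: s (1%G) ps {def_GN} => [|K s IHs] H //= /andP[stepHK ps].
exact: connect_trans (connect1 (pre_step _ _ stepHK)) (IHs _ ps).
Qed.

(** Let K be the first term of the series that meets M nontrivially. By
    minimality M lies in K, and it meets the preceding term H trivially, so it
    embeds in the cyclic group K / H. *)
Lemma supersolvable_minnormal_cyclic gT (G M : {group gT}) :
  supersolvable G -> minnormal M G -> M \subset G -> cyclic M.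
Proof.
case=> s ps def_G /mingroupP[/andP[ntM nMG] minM] sMG0.
have sMG: M \subset last 1%G s by rewrite def_G.
have TI: 1%G :&: M = 1 by rewrite setI1g.
elim: s (1%G) TI ps sMG {def_G} => [|K s IHs] H TI /=.
  by move=> _ sMH; case/negP: ntM; rewrite -subG1 -TI subsetI sMH /=.
case/andP=> /and4P[nsHG nsKG sHK cycKH] ps sML.
have [TIK | ntKM] := eqVneq (K :&: M) 1; first exact: IHs TIK ps sML.
have defKM : (K :&: M)%G = M.
  apply: val_inj; apply: minM; last exact: subsetIr.
  by rewrite ntKM normsI // normal_norm.
have sMK : M \subset K by rewrite -defKM subsetIl.
have nHM : M \subset 'N(H).
  exact: subset_trans (subset_trans sMK (normal_sub nsKG)) (normal_norm nsHG).
rewrite (isog_cyclic (quotient_isog nHM TI)).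
exact: cyclicS (quotientS _ sMK) cycKH.
Qed.

End Supersolvable.

(** * Nonabelian minimal normal subgroups *)

Section Counting.
Local Open Scope group_scope.
Local Open Scope nat_scope.

(** The Cauchy-Frobenius formula for the conjugation action. *)
Lemma sum_card_cent1 (gT : finGroupType) (M : {group gT}) :
  \sum_(y in M) #|'C_M[y]%g| = #|classes M| * #|M|.
Proof.
have actM : [acts M, on M | 'J] by rewrite astabsJ normG.
have -> : #|classes M| = #|orbit 'J M @: M|.
  by congr #|pred_of_set _|; apply: eq_imset => y; rewrite orbitJ.
rewrite -(Frobenius_Cauchy actM); apply: eq_bigr => y My.
by rewrite afixJ cent_set1.
Qed.

(** The pairs (u, uy) of square roots of 1 in xM are sorted according to
    y in M. All the u occurring for a given y invert y by conjugation, hence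
    differ by elements of the centralizer of y, and the orders of these
    centralizers add up to the number of classes times the order of M. *)
Lemma sqrt1_coset_classes (gT : finGroupType) (G M : {group gT}) x :
  M <| G -> x \in G ->
  #|coset_sqrt1 G M x| ^ 2 <= #|classes M| * #|M|.
Proof.
move=> nsMG Gx; set J := coset_sqrt1 G M x.
have sJM : J \subset M by apply/subsetP=> m; rewrite inE => /andP[].
have -> : #|J| ^ 2 = \sum_(y in M) #|[set m in J | (m * y)%g \in J]|.
  transitivity (\sum_(m in J) \sum_(y in M) ((m * y)%g \in J : nat)).
    rewrite -mulnn -sum_nat_const; apply: eq_bigr => m Jm.
    rewrite -big_mkcondr sum1_card -(card_lcoset J m^-1)%g /=.
    apply: eq_card => y; rewrite mem_lcoset invgK unfold_in /=.
    apply/esym/andb_idl => /(subsetP sJM).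
    by rewrite groupMl // (subsetP sJM).
  rewrite exchange_big /=; apply: eq_bigr => y _.
  rewrite -big_mkcondr sum1_card; apply: eq_card => m.
  by rewrite !inE unfold_in /= !inE.
rewrite -sum_card_cent1; apply: leq_sum => y My.
have [-> | [m0]] := set_0Vmem [set m in J | (m * y)%g \in J].
  by rewrite cards0.
have inv m : m \in J -> (m * y)%g \in J -> (y ^ (x * m) = y^-1)%g.
  rewrite inE => /andP[_ /sqrt1P[_ xm2]].
  rewrite inE mulgA => /andP[_ /sqrt1P[_ xmy2]]; exact: sqrt1_mul_conj.
rewrite inE => /andP[Jm0 Jm0y]; rewrite -(card_lcoset 'C_M[y]%g m0).
apply: subset_leq_card; apply/subsetP => m; rewrite inE => /andP[Jm Jmy].
rewrite mem_lcoset inE groupM ?groupV ?(subsetP sJM) //=.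
apply/cent1P/commute_sym/commgP/conjg_fixP.
have -> : (m0^-1 * m = (x * m0)^-1 * (x * m))%g by rewrite invMg !mulgA mulgKV.
by rewrite conjgM -{1}[y]invgK -(inv m0) // conjVg conjgK conjVg inv // invgK.
Qed.

End Counting.

Section Degrees.
Local Open Scope ring_scope.

(** By the Cayley-Hamilton theorem A^2 - (tr A) A + 1 = 0, so (tr A) A = 2;
    the trace cannot vanish, and A is scalar. The proof reads this off the
    entries. *)
Lemma sqrt1_mx22_scalar (F : fieldType) (A : 'M[F]_2) :
  (2%:R != 0 :> F) -> A *m A = 1%:M -> \det A = 1 -> is_scalar_mx A.
Proof.
move=> nz2 A2 detA; have e i j := congr1 (fun B : 'M_2 => B i j) A2.
move: (e 0 0) (e 0 1) (e 1 0) (e 1 1) detA; rewrite (expand_det_row _ 0) !mxE /=.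
rewrite !big_ord_recl !big_ord0 /cofactor !det_mx11 !mxE /=.
have -> : ord0 = 0 :> 'I_2 by apply: val_inj.
have l0 (j : 'I_1) : lift 0 j = 1 :> 'I_2 by apply: val_inj; rewrite ord1.
have l1 (j : 'I_1) : lift 1 j = 0 :> 'I_2 by apply: val_inj; rewrite ord1.
rewrite !(l0, l1) /= expr0 expr1 !mul1r !mulN1r.
set a := A 0 0; set b := A 0 1; set c := A 1 0; set d := A 1 1.
rewrite !addr0 => aa ab ca dd det.
have nz_tr : a + d != 0.
  apply: contra nz2 => /eqP tr0; apply/eqP.
  have def_d : d = - a by apply/eqP; rewrite -addr_eq0 addrC tr0.
  have -> : 2%:R = (a * a + b * c) + (a * d + b * - c) by rewrite aa det.
  by rewrite def_d; ring.
have b0 : b = 0 by apply: (mulfI nz_tr); rewrite mulr0; apply: etrans ab; ring.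
have c0 : c = 0 by apply: (mulfI nz_tr); rewrite mulr0; apply: etrans ca; ring.
have ad : a = d.
  apply/eqP; rewrite -subr_eq0; apply/eqP; apply: (mulfI nz_tr).
  have e0 : (a * a + b * c) - (c * b + d * d) = 0 by rewrite aa dd subrr.
  by rewrite mulr0; apply: etrans e0; rewrite b0 c0; ring.
apply/is_scalar_mxP; exists a; apply/matrixP=> i j; rewrite !mxE.
have ord2 (k : 'I_2) : k = 0 \/ k = 1.
  by case: k => [[|[|//]] k2]; [left | right]; apply: val_inj.
by case: (ord2 i) (ord2 j) => -> [] ->; rewrite ?eqxx ?mulr1n ?mulr0n.
Qed.

(** The determinant of a representation of a perfect group is trivial, so
    [sqrt1_mx22_scalar] applies. *)
Lemma sqrt1_sub_rcenter (gT : finGroupType) (M : {group gT}) n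
    (rG : mx_representation algC M n) :
  M^`(1)%g = M -> n = 2 -> sqrt1 M \subset rcenter rG.
Proof.
move=> perfM n2; subst n; apply/subsetP=> x /sqrt1P[Mx x2]; rewrite inE Mx.
apply: sqrt1_mx22_scalar; first by rewrite pnatr_eq0.
  by rewrite -repr_mxM // -(expgS x 1) x2 repr_mx1.
have Kx : x \in cfker (detRepr rG).
  by rewrite (subsetP (lin_char_der1 (detRepr_lin_char rG))) ?perfM.
have := cfker1 Kx; rewrite (lin_char1 (detRepr_lin_char rG)) => <-.
by rewrite cfunE Mx mulr1n /= mxtrace_scalar.
Qed.

(** Degree 1 is excluded because M is perfect. In degree 2 the group has
    even order, since degrees divide the order, and all the square roots of 1
    act by scalars; as they generate M, so does M itself, which contradicts
    irreducibility. *)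
Lemma irr_degree_ge3 (gT : finGroupType) (M : {group gT}) (i : Iirr M) :
  M^`(1)%g = M -> (~~ odd #|M| -> <<sqrt1 M>>%g = M) -> i != 0 ->
  (2 < irr_degree (socle_of_Iirr i))%N.
Proof.
move=> perfM genM nz_i; pose n : nat := irr_degree (socle_of_Iirr i).
rewrite -/n; have def_n : 'chi_i 1%g = n%:R by rewrite irr1_degree.
have n_gt0 : (0 < n)%N by rewrite irr_degree_gt0.
have n_neq1 : n != 1%N.
  apply: contra nz_i => /eqP n1; rewrite -subGcfker -{1}perfM -lin_irr_der1.
  by rewrite qualifE; apply/andP; split; rewrite ?irr_char //= def_n n1.
have n_neq2 : n != 2%N.
  apply/eqP => n2; have even_M : ~~ odd #|M|.
    by rewrite -dvdn2 -(dvdC_nat 2); have := dvd_irr1_cardG i; rewrite def_n n2.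
  have sMZ : M \subset ('Z('chi_i)%CF).
    rewrite -(irrRepr i) cfcenter_repr -{1}(genM even_M) gen_subG.
    exact: sqrt1_sub_rcenter.
  have := (irr1_bound i).1; rewrite def_n n2.
  have /eqP -> : #|M : 'Z('chi_i)%CF|%g == 1%N by rewrite indexg_eq1.
  by rewrite -natrX ler_nat.
by move: n n_gt0 n_neq1 n_neq2 {def_n} => [|[|[|]]].
Qed.

Lemma card_sum_irr_degree (gT : finGroupType) (M : {group gT}) :
  #|M| = (1 + \sum_(i : Iirr M | i != 0%R) irr_degree (socle_of_Iirr i) ^ 2)%N.
Proof.
apply/eqP; rewrite -(eqr_nat algC) -irr_sum_square (bigD1 0) //=.
rewrite irr0 cfun11 expr1n natrD natr_sum; apply/eqP; congr (_ + _).
by apply: eq_bigr => i _; rewrite natrX irr1_degree.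
Qed.

(** The nontrivial irreducible characters have degree at least 3 and the
    squares of the degrees add up to the order. With only two classes, the
    order would be 1 + d^2 for the only nontrivial degree d, which divides it. *)
Lemma perfect_card_classes (gT : finGroupType) (M : {group gT}) :
  M :!=: 1%g -> M^`(1)%g = M -> (~~ odd #|M| -> <<sqrt1 M>>%g = M) ->
  (9 * #|classes M| <= #|M| + 8)%N && (2 < #|classes M|)%N.
Proof.
move=> ntM perfM genM; rewrite -NirrE; have defM := card_sum_irr_degree M.
have deg3 := irr_degree_ge3 perfM genM.
have cardI : #|[pred i : Iirr M | i != 0]| = (Nirr M).-1.
  by rewrite cardC1 card_ord.
have nz1 := Iirr1_neq0 ntM; set i1 := inord 1 in nz1.
apply/andP; split.
  have : (\sum_(i : Iirr M | i != 0%R) 9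
           <= \sum_(i : Iirr M | i != 0%R) irr_degree (socle_of_Iirr i) ^ 2)%N.
    by apply: leq_sum => i /deg3; set n := irr_degree _; nia.
  rewrite sum_nat_const cardI; move: defM; set S := (\sum_(_ | _) _)%N.
  by have := ltn_ord i1; lia.
rewrite ltnNge; apply/negP => k_le2.
have def_ord i : i != 0 -> i = i1.
  move=> nz_i; apply: val_inj; rewrite /= inordK; last first.
    by have := ltn_ord i; move: nz_i; rewrite -val_eqE /=; lia.
  by have := ltn_ord i; move: nz_i; rewrite -val_eqE /=; lia.
have := dvd_irr1_cardG i1; rewrite irr1_degree dvdC_nat.
rewrite defM (bigD1 i1) //= big1 ?addn0; last first.
  by move=> i /andP[/def_ord-> /eqP].
rewrite dvdn_addl ?dvdn_exp // dvdn1 => /eqP deg1.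
by have := deg3 i1 nz1; rewrite deg1.
Qed.

(** Let J be the number to be bounded, m the order and k the class number
    of M. Then J^2 <= k m and 9 k <= m + 8, so J >= 5/12 m would force m <= 14,
    whereas k >= 3 gives m >= 19. Minimality makes M perfect and, when its order
    is even, generated by its square roots of 1. *)
Lemma nonabelian_sqrt1_coset (gT : finGroupType) (G M : {group gT}) x :
  minnormal M G -> (M <| G)%g -> ~~ abelian M -> x \in G ->
  (12 * #|coset_sqrt1 G M x| < 5 * #|M|)%N.
Proof.
move=> minM nsMG nabM Gx; have [/andP[ntM nMG] Mmin] := mingroupP minM.
have perfM : M^`(1)%g = M.
  apply: Mmin; last exact: der_sub.
  by rewrite (sameP eqP derG1P) nabM /= (char_norm_trans (der_char 1 M)).
have genM : ~~ odd #|M| -> <<sqrt1 M>>%g = M.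
  move=> even_M; rewrite -dvdn2 in even_M.
  have [z Mz oz] := Cauchy (isT : prime 2) even_M.
  apply: Mmin; last by rewrite gen_subG; apply/subsetP=> y /sqrt1P[].
  apply/andP; split.
    apply/trivgPn; exists z; last by rewrite -order_gt1 oz.
    by rewrite mem_gen //; apply/sqrt1P; rewrite Mz -oz expg_order.
  apply: norms_gen; apply/subsetP=> g Gg; rewrite inE.
  apply/subsetP=> _ /imsetP[y /sqrt1P[My y2] ->]; apply/sqrt1P.
  by rewrite memJ_norm ?(subsetP nMG) // -conjXg y2 conj1g.
have /andP[kM k_gt2] := perfect_card_classes ntM perfM genM.
have := sqrt1_coset_classes nsMG Gx; set J := #|_|; set k := #|_|.
rewrite -/k in kM k_gt2.
move: #|M| kM => m kM leJ; nia.
Qed.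

End Degrees.

(** * Square roots of 1 in the cosets of an abelian normal subgroup *)

Section AbelianCosets.
Local Open Scope nat_scope.
Local Open Scope group_scope.

Implicit Types gT : finGroupType.

Lemma proper_double gT (H G : {group gT}) :
  H \proper G -> (2 * #|H| <= #|G|)%N.
Proof.
move=> prHG; rewrite -(Lagrange (proper_sub prHG)) mulnC leq_mul2l.
by rewrite indexg_gt1 (proper_subn prHG) orbT.
Qed.

Lemma eq_of_lt_double gT (H G : {group gT}) :
  H \subset G -> (#|G| < 2 * #|H|)%N -> H :=: G.
Proof.
move=> sHG ltGH; apply/eqP; apply: contraLR ltGH => neHG; rewrite -leqNgt.
by rewrite proper_double // properEneq neHG.
Qed.

Definition inverted gT (M : {set gT}) (x : gT) : {set gT} :=
  [set m in M | m ^ x == m^-1].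

Lemma invertedP gT (M : {set gT}) x m :
  reflect (m \in M /\ m ^ x = m^-1) (m \in inverted M x).
Proof. by rewrite inE; apply: (iffP andP) => [[-> /eqP] | [-> ->]]. Qed.

Lemma group_set_inverted gT (M : {group gT}) x :
  abelian M -> group_set (inverted M x).
Proof.
move=> abM; apply/group_setP; split=> [|m n /invertedP[Mm mx] /invertedP[Mn nx]].
  by apply/invertedP; rewrite conj1g invg1.
apply/invertedP; split; first exact: groupM.
by rewrite conjMg mx nx invMg (centsP abM) ?groupV.
Qed.

Lemma coset_sqrt1_sub gT (G M : {set gT}) x : coset_sqrt1 G M x \subset M.
Proof. by apply/subsetP=> m /coset_sqrt1P[]. Qed.

Lemma card_coset_sqrt1_le gT (G M : {set gT}) x :
  (#|coset_sqrt1 G M x| <= #|M|)%N.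
Proof. exact: subset_leq_card (coset_sqrt1_sub _ _ _). Qed.

(** For x = x^-1, the equation (x m)^2 = 1 reads m^x = m^-1. *)
Lemma coset_sqrt1_inverted gT (G M : {group gT}) x :
  M \subset G -> x \in sqrt1 G -> coset_sqrt1 G M x = inverted M x.
Proof.
move=> /subsetP sMG /sqrt1P[Gx x2]; have xV := sqrt1_invg x2.
apply/setP=> m; apply/coset_sqrt1P/invertedP => [[Mm _ xm2] | [Mm mx]].
  split=> //; have := sqrt1_invg xm2; rewrite invMg xV => mV.
  by rewrite conjgE xV mulgA -mV -mulgA -{1}xV mulVg mulg1.
split=> //; first by rewrite groupM // sMG.
by rewrite expgS expg1 mulgA -[x * m * x]mulgA -{1}xV -conjgE mx mulVg.
Qed.

Lemma card_coset_sqrt1_shift gT (G M : {group gT}) x m :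
  m \in M -> #|coset_sqrt1 G M (x * m)| = #|coset_sqrt1 G M x|.
Proof.
move=> Mm; rewrite -[RHS](card_lcoset _ m^-1); apply: eq_card => n.
rewrite mem_lcoset invgK !inE mulgA; congr (_ && _).
by rewrite groupMl.
Qed.

Lemma coset_sqrt1_rep gT (G M : {group gT}) x m :
  M \subset G -> m \in coset_sqrt1 G M x ->
  x * m \in sqrt1 G /\ #|coset_sqrt1 G M x| = #|inverted M (x * m)|.
Proof.
move=> sMG /coset_sqrt1P[Mm Gxm xm2].
have Ixm : x * m \in sqrt1 G by apply/sqrt1P.
by rewrite -(coset_sqrt1_inverted sMG Ixm) card_coset_sqrt1_shift.
Qed.

(** As x^2 centralizes M, the product of m and m^x is a fixed point of x in
    M, hence trivial. *)
Lemma inverted_all gT (M : {group gT}) x :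
  abelian M -> x \in 'N(M) -> x ^+ 2 \in 'C(M) -> 'C_M[x] = 1 ->
  inverted M x = M.
Proof.
move=> abM nMx /centP cx2 regx; apply/setP=> m; apply/invertedP/idP=> [[]//|Mm].
split=> //; have Mmx : m ^ x \in M by rewrite memJ_norm.
have : m * m ^ x \in 'C_M[x].
  rewrite inE groupM //=; apply/cent1P/commgP/conjg_fixP.
  have -> : (m * m ^ x) ^ x = m ^ x * m.
    rewrite conjMg -conjgM; congr (_ * _); apply/conjg_fixP/commgP.
    exact/commute_sym/cx2.
  exact: (centsP abM).
rewrite regx => /set1P/eqP; rewrite -eq_invg_mul => /eqP->//.
Qed.

(** Two elements that both invert M differ by an element that centralizes
    it. *)
Lemma inverted_coset gT (G M : {group gT}) x y :
  x \in G -> y \in G -> inverted M x = M -> inverted M y = M ->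
  M <| G -> x^-1 * y \in 'C_G(M).
Proof.
move=> Gx Gy invx invy nsMG; rewrite inE groupM ?groupV //=.
apply/centP=> m Mm; apply/commute_sym/commgP/conjg_fixP.
have Mm' : m ^ x^-1 \in M by rewrite memJ_norm ?groupV ?(subsetP (normal_norm nsMG)).
move: (Mm'); rewrite -{1}invx => /invertedP[_].
rewrite conjgKV => mE; move: Mm'; rewrite -{1}invy => /invertedP[_].
by rewrite conjgM => ->; rewrite {2}mE.
Qed.

End AbelianCosets.

(** * Minimal normal subgroups of odd order *)

Section OddArith.
Local Open Scope nat_scope.

(** Here j is the number of square roots of 1 in a coset of M, m the order
    of M, and c tells whether the coset centralizes M. *)
Lemma coset_weight_le (m j : nat) (c : bool) : 9 <= m -> (j != m -> 3 * j <= m) ->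
  (c -> j <= 1) -> 3 * j + c * (m - 3) <= m + (j == m) * (2 * m).
Proof.
move=> m9 j3 cj; case: eqP j3 => [e | _] j3; last have {}j3 := j3 isT.
  by clear j3; case: c cj => cj; [have {}cj := cj isT; lia | lia].
by case: c cj => cj; [have {}cj := cj isT; lia | lia].
Qed.

(** Here c and t are the numbers of elements that centralize and that
    invert M, m and g the orders of M and of the group, and i the number of
    square roots of 1. *)
Lemma mean_coset_weight (m c g i t : nat) : 9 <= m ->
  3 * m * i + (m - 3) * c <= m * g + 2 * m * t -> 9 * i + 2 * c <= 3 * g + 6 * t.
Proof.
move=> m9 H; rewrite -(@leq_pmul2l m); last exact: leq_trans m9.
have : 2 * m * c <= 3 * (m - 3) * c by rewrite leq_mul2r; apply/orP; right; lia.
lia.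
Qed.

End OddArith.

Section OddCase.
Local Open Scope nat_scope.
Local Open Scope group_scope.

Implicit Types gT : finGroupType.

Lemma card_inverted_dvd gT (M : {group gT}) x :
  abelian M -> #|inverted M x| %| #|M|.
Proof.
move=> abM; have sIM : inverted M x \subset M by apply/subsetP=> m /invertedP[].
exact: (@cardSg _ M (Group (group_set_inverted x abM)) sIM).
Qed.

Lemma card_coset_sqrt1_full gT (G M : {group gT}) x :
  M \subset G -> #|coset_sqrt1 G M x| = #|M| ->
  x \in sqrt1 G /\ inverted M x = M.
Proof.
move=> sMG eqJM.
have defJ : coset_sqrt1 G M x = M.
  by apply/eqP; rewrite eqEcard coset_sqrt1_sub eqJM leqnn.
have : 1 \in coset_sqrt1 G M x by rewrite defJ group1.
case/(coset_sqrt1_rep sMG); rewrite mulg1 => Ix _; split=> //.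
by rewrite -(coset_sqrt1_inverted sMG Ix).
Qed.

(** The number is the order of a subgroup of M, so it is at most a third of
    the odd order of M when it is not the whole. *)
Lemma card_coset_sqrt1_odd gT (G M : {group gT}) x :
  M \subset G -> abelian M -> odd #|M| -> #|coset_sqrt1 G M x| != #|M| ->
  (3 * #|coset_sqrt1 G M x| <= #|M|)%N.
Proof.
move=> sMG abM oddM neqM.
have [-> | [m Jm]] := set_0Vmem (coset_sqrt1 G M x); first by rewrite cards0.
have [_ defJ] := coset_sqrt1_rep sMG Jm.
have := card_inverted_dvd (x * m) abM; rewrite -defJ => /dvdnP[k def_k].
move: neqM oddM; rewrite {}def_k; set j := #|_|.
case: k => [|[|[|k]]]; rewrite ?mul1n ?eqxx ?mul2n ?odd_double // => _ _.
by rewrite leq_mul2r orbT.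
Qed.

(** An element of M that is both inverted and fixed squares to 1, hence is
    trivial in odd order. *)
Lemma card_coset_sqrt1_cent gT (G M : {group gT}) x :
  M \subset G -> abelian M -> odd #|M| -> x \in 'C(M) ->
  (#|coset_sqrt1 G M x| <= 1)%N.
Proof.
move=> sMG abM oddM /centP cMx.
have [-> | [m Jm]] := set_0Vmem (coset_sqrt1 G M x); first by rewrite cards0.
have [_ ->] := coset_sqrt1_rep sMG Jm; have /coset_sqrt1P[Mm _ _] := Jm.
rewrite -(cards1 (1 : gT)); apply: subset_leq_card; apply/subsetP=> n.
case/invertedP=> Mn; have -> : n ^ (x * m) = n.
  apply/conjg_fixP/commgP/commuteM; first exact/commute_sym/cMx.
  exact: (centsP abM).
move=> nV; rewrite inE -order_eq1 -dvdn1 -(eqP (_ : coprime #|M| 2)).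
  by rewrite dvdn_gcd order_dvdG //= order_dvdn expgS expg1 {2}nV mulgV.
by rewrite coprime_sym coprime2n.
Qed.

(** By [card_coset_sqrt1_full], these are the square roots of 1 of G whose
    conjugation inverts every element of M. The definition is in terms of the
    count because that is how they enter the sum over cosets. *)
Definition inverting gT (G M : {group gT}) : {set gT} :=
  [set x in G | #|coset_sqrt1 G M x| == #|M|].

Lemma invertingP gT (G M : {group gT}) x : M \subset G ->
  x \in inverting G M -> [/\ x \in G, x \in sqrt1 G & inverted M x = M].
Proof.
by move=> sMG; rewrite inE => /andP[Gx /eqP/(card_coset_sqrt1_full sMG)[]].
Qed.

Lemma card_inverting gT (G M : {group gT}) :
  M <| G -> (#|inverting G M| <= #|'C_G(M)|)%N.
Proof.
move=> nsMG; have sMG := normal_sub nsMG.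
have [-> | [t Tt]] := set_0Vmem (inverting G M); first by rewrite cards0.
have [Gt _ invt] := invertingP sMG Tt.
rewrite -(card_lcoset 'C_G(M) t); apply: subset_leq_card.
apply/subsetP=> x /(invertingP sMG)[Gx _ invx]; rewrite mem_lcoset.
exact: inverted_coset invt invx nsMG.
Qed.

(** Products of elements acting on M as 1 or -1 act as 1 or -1. *)
Lemma inverting_gen gT (G M : {group gT}) t : abelian M -> M <| G ->
  t \in G -> inverted M t = M ->
  {in 'C_G(M) <*> <[t]>, forall g, g \in 'C(M) \/ inverted M g = M}.
Proof.
move=> abM nsMG Gt invt g.
have nCt : <[t]> \subset 'N('C_G(M)).
  by rewrite cycle_subG (subsetP _ t Gt) // normsI ?normG // norms_cent // normal_norm.
rewrite norm_joinEr // => /mulsgP[c _ /setIP[Gc cMc] /cycleP[k ->] ->].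
have inv n : n \in M -> n ^ t = n^-1.
  by rewrite -{1}invt => /invertedP[].
have fixc n : n \in M -> n ^ c = n.
  by move=> Mn; apply/conjg_fixP/commgP/commute_sym/(centP cMc).
have act : (forall n, n \in M -> n ^ (c * t ^+ k) = n)
         \/ (forall n, n \in M -> n ^ (c * t ^+ k) = n^-1).
  elim: k => [|k [] IHk]; [left | right | left] => n Mn.
  - by rewrite mulg1 fixc.
  - by rewrite expgSr mulgA conjgM IHk ?inv.
  - by rewrite expgSr mulgA conjgM IHk // inv ?groupV // invgK.
case: act => [fix_g | inv_g]; [left | right].
  by apply/centP=> n Mn; apply/commute_sym/commgP/conjg_fixP/fix_g.
by apply/setP=> n; apply/invertedP/idP=> [[]// | Mn]; split; rewrite ?inv_g.
Qed.

Lemma sum_indicator gT (G A : {set gT}) n : A \subset G ->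
  (n * #|A| = \sum_(x in G) (x \in A) * n)%N.
Proof.
move=> /subsetP sAG; rewrite mulnC -sum_nat_const big_mkcond [RHS]big_mkcond /=.
apply: eq_bigr => x _; case: ifP => [/sAG-> | _]; first by rewrite mul1n.
by rewrite mul0n if_same.
Qed.

(** Suppose that at least 5/12 of the elements of G square to 1, and let C
    be the centralizer of M. A coset of M outside C consists of square roots of
    1 for at most a third, unless it inverts M, so some t inverts M and
    |G : C| <= 16/3. If some square root x of 1 acts neither as 1 nor as -1,
    then C, t and x generate at least 4 |C| elements normalizing the fixed
    points of x in M, so these fixed points form a normal subgroup of G; it is
    trivial by minimality, and x inverts M after all. Otherwise only the cosets
    of C and of tC matter, |G : C| <= 8/3, and G acts on M as 1 and -1: every
    subgroup of M is normal and M is cyclic. *)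
Lemma odd_minnormal_sqrt1 gT (G M : {group gT}) :
  minnormal M G -> M \subset G -> abelian M -> odd #|M| -> ~~ cyclic M ->
  (12 * #|sqrt1 G| < 5 * #|G|)%N.
Proof.
move=> minM sMG abM oddM ncycM; have [/andP[ntM nMG] Mmin] := mingroupP minM.
have nsMG : M <| G by apply/andP.
have M_ge9 : (9 <= #|M|)%N.
  rewrite leqNgt; apply: contra ncycM => M_lt9.
  have ntM1 : (#|M| != 1)%N by rewrite -trivg_card1.
  apply: prime_cyclic; move: (#|M|) M_lt9 oddM ntM1.
  by do 9![case=> //].
rewrite ltnNge; apply/negP=> many.
set C := 'C_G(M)%G; set T := inverting G M.
have sum := sum_sqrt1_coset sMG.
have sTG : T \subset G by apply/subsetP=> x; rewrite inE => /andP[].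
have sCG : C \subset G by apply: subsetIl.
have leTC : (#|T| <= #|C|)%N := card_inverting nsMG.
have notTC x : x \in T -> x \in C -> False.
  rewrite inE => /andP[_ /eqP eqM] /setIP[_ Cx].
  have := card_coset_sqrt1_cent sMG abM oddM Cx.
  by rewrite eqM leqNgt (leq_trans _ M_ge9).
(* Cosets outside C that do not invert M are at most one third full. *)
have bound1 : (3 * #|M| * #|sqrt1 G| + (#|M| - 3) * #|C|
     <= #|M| * #|G| + 2 * #|M| * #|T|)%N.
  rewrite -mulnA -sum big_distrr /=.
  have -> : ((#|M| - 3) * #|C| = \sum_(x in G) (x \in C) * (#|M| - 3))%N.
    exact: sum_indicator.
  have -> : (2 * #|M| * #|T| = \sum_(x in G) (x \in T) * (2 * #|M|))%N.
    exact: sum_indicator.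
  have -> : (#|M| * #|G| = \sum_(x in G) #|M|)%N.
    by rewrite sum_nat_const mulnC.
  rewrite -!big_split /=; apply: leq_sum => x Gx.
  have -> : x \in T = (#|coset_sqrt1 G M x| == #|M|) by rewrite inE Gx.
  have -> : x \in C = (x \in 'C(M)) by rewrite inE Gx.
  apply: coset_weight_le => // [|Cx]; last exact: card_coset_sqrt1_cent.
  exact: card_coset_sqrt1_odd.
have {}bound1 := mean_coset_weight M_ge9 bound1.
have [T0 | [t Tt]] := set_0Vmem T.
  move: bound1 (cardG_gt0 C); rewrite T0 cards0; clear -many; lia.
have [Gt It invt] := invertingP sMG Tt.
have G_le : (3 * #|G| <= 16 * #|C|)%N by clear -many bound1 leTC; lia.
pose A := (C <*> <[t]>)%G.
have sAG : A \subset G by rewrite join_subG sCG cycle_subG.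
have actA : {in A, forall g, g \in 'C(M) \/ inverted M g = M}.
  exact: inverting_gen.
have A_ge : (2 * #|C| <= #|A|)%N.
  apply: proper_double; rewrite properE joing_subl; apply/subsetPn; exists t.
    by rewrite mem_gen // inE cycle_id orbT.
  by apply/negP => /(notTC t Tt).
(* A square root of 1 outside A normalizes its fixed points in M along with A,
   so that the normalizer of these fixed points has index less than 2. *)
have [x /andP[Ix Ax'] | allA] := pickP [pred x in sqrt1 G | x \notin A].
  have /sqrt1P[Gx x2] := Ix.
  have nCx : G \subset 'N('C_M[x]).
    pose L := 'N_G('C_M[x])%G; suff <- : L :=: G by apply: subsetIr.
    apply: eq_of_lt_double; first exact: subsetIl.
    have sAL : A \subset L.
      rewrite subsetI sAG; apply/subsetP=> g Ag; rewrite inE.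
      apply/subsetP=> _ /imsetP[m /setIP[Mm cxm] ->].
      case: (actA g Ag) => [cg | invg].
        have -> : m ^ g = m by apply/conjg_fixP/commgP/commute_sym/(centP cg).
        by rewrite inE Mm.
      have : m \in inverted M g by rewrite invg.
      by case/invertedP=> _ ->; rewrite groupV inE Mm.
    have prAL : A \proper L.
      rewrite properE sAL; apply/subsetPn; exists x => //.
      rewrite inE Gx inE; apply/subsetP=> _ /imsetP[m /setIP[Mm cxm] ->].
      have -> : m ^ x = m by apply/conjg_fixP/commgP/cent1P.
      by rewrite inE Mm.
    by move: (proper_double prAL) (cardG_gt0 C); clear -G_le A_ge; lia.
  have regx : 'C_M[x] = 1.
    apply/eqP; apply: contraR Ax' => ntC.
    have CM : 'C_M[x] = M by apply: Mmin; rewrite ?ntC ?subsetIl.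
    rewrite mem_gen // inE [x \in C]inE Gx /= -sub_cent1 -{1}CM.
    by rewrite subsetIr.
  have invx : inverted M x = M.
    by apply: inverted_all; rewrite ?(subsetP nMG) ?x2 ?group1.
  case/negP: Ax'; rewrite -(mulKVg t x); apply: groupM.
    by rewrite mem_gen // inE cycle_id orbT.
  by rewrite mem_gen // inE (inverted_coset Gt Gx).
have IA x : x \in sqrt1 G -> x \in A.
  by move=> Ix; have := allA x; rewrite /= Ix /= => /negbFE.
(* Now only the elements of A contribute to the sum over cosets. *)
have bound2 : (#|M| * #|sqrt1 G| <= #|M| * #|T| + #|C|)%N.
  rewrite -sum.
  have -> : (#|M| * #|T| = \sum_(x in G) (x \in T) * #|M|)%N.
    exact: sum_indicator.
  have -> : (#|C| = \sum_(x in G) (x \in C))%N.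
    by rewrite -(mul1n #|C|) (sum_indicator 1 sCG); apply: eq_bigr => x _; rewrite muln1.
  rewrite -!big_split /=; apply: leq_sum => x Gx.
  have [-> | [m Jm]] := set_0Vmem (coset_sqrt1 G M x); first by rewrite cards0.
  have [Ixm eqJ] := coset_sqrt1_rep sMG Jm; have /coset_sqrt1P[Mm _ _] := Jm.
  case: (actA _ (IA _ Ixm)) => [cxm | invxm].
    have Cx : x \in C.
      by rewrite inE Gx -(groupMr _ (subsetP abM m Mm)).
    rewrite Cx; apply: leq_trans (leq_addl _ _).
    by rewrite card_coset_sqrt1_cent //; case/setIP: Cx.
  by rewrite /T inE Gx eqJ invxm eqxx mul1n leq_addr.
have {}bound2 : (9 * #|sqrt1 G| <= 9 * #|T| + #|C|)%N.
  by clear -M_ge9 bound2; nia.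
have cycG m : m \in M -> G \subset 'N(<[m]>).
  move=> Mm; pose L := 'N_G(<[m]>)%G; suff <- : L :=: G by apply: subsetIr.
  apply: eq_of_lt_double; first exact: subsetIl.
  have sAL : A \subset L.
    rewrite subsetI sAG; apply/subsetP=> g Ag; rewrite inE -cycleJ cycle_subG.
    case: (actA g Ag) => [cg | invg].
      have -> : m ^ g = m by apply/conjg_fixP/commgP/commute_sym/(centP cg).
      exact: cycle_id.
    have : m \in inverted M g by rewrite invg.
    by case/invertedP=> _ ->; rewrite groupV cycle_id.
  move: (subset_leq_card sAL) (cardG_gt0 C).
  by clear -many bound2 leTC A_ge; lia.
have [m Mm ntm] := trivgPn _ ntM.
case/negP: ncycM; apply/cyclicP; exists m; apply/esym/Mmin.
  by rewrite cycle_eq1 ntm cycG.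
by rewrite cycle_subG.
Qed.

End OddCase.

(** * Minimal normal 2-subgroups *)

Section Order6Arith.
Local Open Scope nat_scope.

(** Here r and h are the orders of R and H, d and t count the elements of H
    that centralize and that invert R, and i counts the square roots of 1. *)
Lemma order6_no_inversion r d i h : 3 <= r -> r * i <= d + r * 0 -> d <= h ->
  5 * h <= 6 * (i + 1) -> r <= h -> False.
Proof.
move=> r3 le_i dh many rh; have : 3 * i <= r * i by rewrite leq_mul2r r3 orbT.
lia.
Qed.

Lemma order6_inversion r d t i h : 3 <= r -> r * i <= d + r * t -> t <= d ->
  2 * d <= h -> 5 * h <= 6 * (i + 1) -> r <= d -> h = 6 /\ i = 4.
Proof.
move=> r3 le_i td dh many rd.
have : 3 * i <= 4 * d.
  rewrite -(@leq_pmul2l r); last exact: leq_trans r3.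
  have : r * t <= r * d by rewrite leq_mul2l td orbT.
  have : 3 * d <= r * d by rewrite leq_mul2r r3 orbT.
  lia.
by move=> le4; split; lia.
Qed.

End Order6Arith.

Section Order6.
Local Open Scope nat_scope.
Local Open Scope group_scope.

Implicit Types gT : finGroupType.

(** An element of H outside the centralizer D of R has no nontrivial fixed
    point in R, so its coset of R contains a square root of 1 only if it
    inverts R. The elements of D account for at most |D| / |R| square roots of
    1 and those inverting R for at most |D|, a total of at most 2/3 |H|. With
    the lower bound this leaves |H| <= 6 and makes all the estimates equalities. *)
Lemma odd_normal_sqrt1_order6 gT (H R : {group gT}) :
  R <| H -> prime #|R| -> odd #|R| -> (5 * #|H| <= 6 * (#|sqrt1 H| + 1))%N ->
  #|H| = 6 /\ #|sqrt1 H| = 4.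
Proof.
move=> nsRH prR oddR many; have sRH := normal_sub nsRH.
have abR : abelian R by rewrite cyclic_abelian ?prime_cyclic.
set D := 'C_H(R)%G; set T := inverting H R.
have sTH : T \subset H by apply/subsetP=> x; rewrite inE => /andP[].
have sDH : D \subset H by apply: subsetIl.
have leTD : (#|T| <= #|D|)%N := card_inverting nsRH.
have R_ge3 : (3 <= #|R|)%N by move: (#|R|) oddR (prime_gt1 prR) => [|[|[|]]].
have bound : (#|R| * #|sqrt1 H| <= #|D| + #|R| * #|T|)%N.
  rewrite -(sum_sqrt1_coset sRH) (sum_indicator _ sTH) -[#|D|]mul1n.
  rewrite (sum_indicator _ sDH) -big_split /=; apply: leq_sum => x Hx.
  have -> : x \in D = (x \in 'C(R)) by rewrite inE Hx.
  case: (boolP (x \in 'C(R))) => cRx /=.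
    by rewrite mul1n -[X in (X <= _)%N]addn0 leq_add // card_coset_sqrt1_cent.
  have [-> | [m Jm]] := set_0Vmem (coset_sqrt1 H R x); first by rewrite cards0.
  have [Ixm eqJ] := coset_sqrt1_rep sRH Jm; have /coset_sqrt1P[Rm Hxm xm2] := Jm.
  suff eqR : #|coset_sqrt1 H R x| = #|R|.
    have Tx : x \in T by rewrite inE Hx eqR eqxx.
    by rewrite Tx eqR mul1n mul0n.
  rewrite eqJ inverted_all // ?xm2 ?group1 //.
    by rewrite (subsetP (normal_norm nsRH)).
  apply: prime_TIg => //; rewrite sub_cent1 groupMr //.
  exact: (subsetP abR).
have leRD : (#|R| <= #|D|)%N by rewrite subset_leq_card // subsetI sRH; exact: abR.
have [T0 | [t Tt]] := set_0Vmem T.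
  exfalso; move: bound; rewrite T0 cards0 => bound.
  exact: order6_no_inversion R_ge3 bound (subset_leq_card sDH) many (subset_leq_card sRH).
have prD : D \proper H.
  rewrite properE sDH; apply/subsetPn; exists t; first exact: (subsetP sTH).
  apply/negP => /setIP[_ cRt]; move: Tt; rewrite inE => /andP[_ /eqP eqR].
  have := card_coset_sqrt1_cent sRH abR oddR cRt.
  by rewrite eqR leqNgt (leq_trans _ R_ge3).
exact: order6_inversion R_ge3 bound leTD (proper_double prD) many leRD.
Qed.

(** The fixed points of x in M form a subgroup normalized by G, because x
    is central modulo the centralizer of M. If it is trivial then x inverts M,
    which in exponent 2 is the same as centralizing it. *)
Lemma central_mod_cent_acts_trivially gT (G M : {group gT}) (x : gT) :
  minnormal M G -> abelian M -> {in M, forall m, m ^+ 2 = 1} ->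
  x \in G -> x ^+ 2 \in 'C(M) -> {in G, forall g, [~ x, g] \in 'C(M)} ->
  x \in 'C(M).
Proof.
move=> minM abM expM Gx x2 xG; have [/andP[ntM nMG] Mmin] := mingroupP minM.
have nMx := subsetP nMG x Gx.
have nC : G \subset 'N('C_M[x]).
  apply/subsetP=> g Gg; rewrite inE; apply/subsetP=> _ /imsetP[m /setIP[Mm cxm] ->].
  have Mmg : m ^ g \in M by rewrite memJ_norm // (subsetP nMG).
  rewrite inE Mmg /=.
  have : (m ^ g) ^ (x ^ g) = m ^ g.
    by rewrite -conjJg; congr (_ ^ g); apply/conjg_fixP/commgP/cent1P.
  have -> : x ^ g = x * [~ x, g] by rewrite commgEl mulKVg.
  have Mmgx : (m ^ g) ^ x \in M by rewrite memJ_norm.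
  have fix_c : ((m ^ g) ^ x) ^ [~ x, g] = (m ^ g) ^ x.
    by apply/conjg_fixP/commgP/commute_sym/(centP (xG g Gg)).
  rewrite conjgM fix_c => fix_x.
  by apply/cent1P/commgP/conjg_fixP.
have [/eqP regx | ntC] := boolP ('C_M[x] == 1).
  have invx := inverted_all abM nMx x2 regx.
  apply/centP=> m Mm; apply/commute_sym/commgP/conjg_fixP.
  move: (Mm); rewrite -{1}invx => /invertedP[_ ->].
  exact: sqrt1_invg (expM m Mm).
have CM : 'C_M[x] = M by apply: Mmin; rewrite ?ntC ?subsetIl.
by rewrite -sub_cent1 -CM subsetIr.
Qed.

End Order6.

Section TwoArith.
Local Open Scope nat_scope.

(** Here c is the order of the centralizer C of M, i and k count the square
    roots of 1 in G and in G / C, and g and h are the orders of these groups. *)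
Lemma two_weight_quotient i c k h g :
  0 < c -> 2 * (c * i) <= c * (c * k + c) -> g = c * h ->
  5 * g <= 12 * i -> 5 * h <= 6 * (k + 1).
Proof.
move=> c0 H -> many; rewrite -(@leq_pmul2l c) //.
have : 2 * i <= c * k + c by rewrite -(@leq_pmul2l c) // mulnCA.
lia.
Qed.

Lemma two_weight_tight i c k h g : 2 * (c * i) <= c * (c * k + c) -> g = c * h ->
  h = 6 -> k = 4 ->
  5 * g <= 12 * i -> 2 * (c * i) == c * (c * k + c).
Proof.
move=> H -> -> k4 many; rewrite k4 in H *.
rewrite eqn_leq H /= [X in _ <= X]mulnCA leq_mul2l.
by apply/orP; right; lia.
Qed.

End TwoArith.

Section TwoCase.
Local Open Scope nat_scope.
Local Open Scope group_scope.

Implicit Types gT : finGroupType.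

(** Choose m in M with m^x <> m. If xc and xcm both square to 1, then xc
    inverts m, that is, fixes it, and so does x. Hence at most one of c and cm
    is counted. *)
Lemma two_coset_sqrt1_half gT (G M : {group gT}) x :
  M <| G -> abelian M -> {in M, forall m, m ^+ 2 = 1} ->
  x \in G -> x \notin 'C(M) ->
  (2 * #|coset_sqrt1 G 'C_G(M) x| <= #|'C_G(M)|)%N.
Proof.
move=> nsMG abM expM Gx ncx; have [sMG nMG] := andP nsMG.
have nMx := subsetP nMG x Gx.
have sMC : M \subset 'C_G(M) by rewrite subsetI sMG.
have [m Mm nfix] : exists2 m, m \in M & m ^ x != m.
  apply/exists_inP; apply: contraR ncx; rewrite negb_exists_in => /forall_inP fix_x.
  apply/centP=> m Mm; apply/commute_sym/commgP/conjg_fixP/eqP.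
  by rewrite -[_ == _]negbK fix_x.
set J := coset_sqrt1 _ _ _.
have dJ : [disjoint J & J :* m].
  rewrite -setI_eq0; apply/eqP/setP => c; rewrite [RHS]inE; apply/negP.
  case/setIP=> /coset_sqrt1P[/setIP[_ cMc] _ xc2] /rcosetP[d].
  case/coset_sqrt1P=> /setIP[_ cMd] _ xd2 def_c.
  have fixM k e : k \in M -> e \in 'C(M) -> k ^ e = k.
    by move=> Mk cMe; apply/conjg_fixP/commgP/commute_sym/(centP cMe).
  have := @sqrt1_mul_conj _ _ m xd2; rewrite -mulgA -def_c => /(_ xc2).
  rewrite conjgM fixM ?memJ_norm // (sqrt1_invg (expM m Mm)) => mx.
  by rewrite mx eqxx in nfix.
rewrite mul2n -addnn -{2}(card_rcoset J m).
have /eqP <- : #|J :|: J :* m| == (#|J| + #|J :* m|)%N.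
  by rewrite (leq_card_setU J (J :* m)).2.
apply: subset_leq_card; rewrite subUset coset_sqrt1_sub /=.
by rewrite mul_subG ?coset_sqrt1_sub // sub1set (subsetP sMC).
Qed.

(** A coset of C contributes at most |C| square roots of 1 if it is C
    itself, at most |C| / 2 if it squares to C, and none otherwise. *)
Lemma two_sqrt1_centralizer_quotient gT (G M C : {group gT}) :
  C :=: 'C_G(M) -> M <| G -> abelian M -> {in M, forall m, m ^+ 2 = 1} ->
  (2 * (#|C| * #|sqrt1 G|) <= #|C| * (#|C| * #|sqrt1 (G / C)| + #|C|)
     ?= iff [forall x in G, 2 * #|coset_sqrt1 G C x| ==
               #|C| * ((coset C x \in sqrt1 (G / C)) + (x \in C))])%N.
Proof.
move=> defC nsMG abM expM; have [sMG nMG] := andP nsMG.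
have sCG : C \subset G by rewrite defC subsetIl.
have nsCG : C <| G by rewrite /normal sCG defC normsI ?normG // norms_cent.
have -> : (2 * (#|C| * #|sqrt1 G|) = \sum_(x in G) 2 * #|coset_sqrt1 G C x|)%N.
  by rewrite -(sum_sqrt1_coset sCG) big_distrr.
have sIQ: sqrt1 (G / C) \subset G / C by apply/subsetP=> x /sqrt1P[].
have -> : (#|C| * (#|C| * #|sqrt1 (G / C)| + #|C|) =
  \sum_(x in G) #|C| * ((coset C x \in sqrt1 (G / C)) + (x \in C)))%N.
  rewrite -(card_preim_quotient nsCG sIQ) mulnDr (sum_indicator #|C| sCG).
  rewrite (@sum_indicator _ G); last by apply/subsetP=> x; rewrite inE => /andP[].
  rewrite -big_split /=; apply: eq_bigr => x Gx.
  by rewrite mulnDr ![(#|C| * _)%N]mulnC [x \in [set _ in _ | _]]inE Gx.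
apply: leqif_sum => x Gx; apply: leqif_eq.
have [Cx | nCx] := boolP (x \in C).
  have -> : coset C x \in sqrt1 (G / C).
    by rewrite coset_id //; apply/sqrt1P; rewrite group1 expg1n.
  by rewrite mulnC leq_mul2r card_coset_sqrt1_le orbT.
rewrite addn0; have [-> | [m Jm]] := set_0Vmem (coset_sqrt1 G C x).
  by rewrite cards0 muln0.
have /coset_sqrt1P[Cm Gxm xm2] := Jm.
have -> : coset C x \in sqrt1 (G / C).
  have Nx := subsetP (normal_norm nsCG) x Gx.
  have -> : coset C x = coset C (x * m).
    rewrite morphM //=; last exact: (subsetP (normG C)).
    by rewrite (coset_id Cm) mulg1.
  apply/sqrt1P; rewrite mem_quotient // -morphX ?xm2 ?morph1 //.
  by rewrite (subsetP (normal_norm nsCG)).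
rewrite muln1 defC; apply: two_coset_sqrt1_half => //.
by apply: contra nCx => cMx; rewrite defC inE Gx.
Qed.

End TwoCase.

Section TwoStruct.
Local Open Scope nat_scope.
Local Open Scope group_scope.

Implicit Types gT : finGroupType.

Lemma cyclic_minnormal_prime gT (G R : {group gT}) :
  minnormal R G -> cyclic R -> prime #|R|.
Proof.
move=> minR cycR; have solR := abelian_sol (cyclic_abelian cycR).
have [_ ntR /is_abelemP[p p_pr abelR]] := minnormal_solvable minR (subxx R) solR.
have pR := abelem_pgroup abelR.
rewrite (card_pgroup pR); suff -> : logn p #|R| = 1%N by [].
apply/eqP; rewrite eqn_leq -(abelem_cyclic abelR) cycR lt0n.
by apply: contra ntR => /eqP log0; rewrite trivg_card1 (card_pgroup pR) log0.
Qed.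

Lemma noncyclic_card_ge4 gT (M : {group gT}) : ~~ cyclic M -> (4 <= #|M|)%N.
Proof.
rewrite leqNgt; apply: contra => M_lt4; have [M1 | ntM] := eqVneq M 1%G.
  by rewrite M1 cyclic1.
have ntM1 : (#|M| != 1)%N by rewrite -trivg_card1.
by apply: prime_cyclic; move: (#|M|) M_lt4 ntM1 (cardG_gt0 M); do 4![case=> //].
Qed.

(** Every subgroup of a central subgroup is normal. *)
Lemma central_minnormal_cyclic gT (G M : {group gT}) :
  minnormal M G -> G \subset 'C(M) -> cyclic M.
Proof.
move=> minM cGM; have [/andP[ntM nMG] Mmin] := mingroupP minM.
have [m Mm ntm] := trivgPn _ ntM; apply/cyclicP; exists m; apply/esym/Mmin.
  rewrite cycle_eq1 ntm /= cents_norm // (subset_trans cGM) // centS //.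
  by rewrite cycle_subG.
by rewrite cycle_subG.
Qed.

(** A nontrivial central element generates a cyclic normal subgroup, whose
    quotient would be supersolvable; it could then be put at the bottom of a
    series of the quotient. *)
Lemma min_nonsupersolvable_center gT (G : {group gT}) :
  ~ supersolvable G ->
  (forall N : {group gT}, N <| G -> N :!=: 1 -> supersolvable (G / N)) ->
  'Z(G) = 1.
Proof.
move=> nssG ssQ; apply/eqP; apply: contra_notT nssG => /trivgPn[z Zz ntz].
have nsz : <[z]> <| G by rewrite sub_center_normal // cycle_subG.
apply: (supersolvable_by_cyclic nsz (cycle_cyclic z)).
by apply: ssQ; rewrite ?cycle_eq1.
Qed.

(** A normal subgroup of order 2 of G / C is central there, and
    [central_mod_cent_acts_trivially] applies to a lift of its generator. *)
Lemma chief_over_cent_odd gT (G M C : {group gT}) (R : {group coset_of C}) :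
  minnormal M G -> M \subset G -> abelian M -> {in M, forall m, m ^+ 2 = 1} ->
  C :=: 'C_G(M) -> R <| G / C -> prime #|R| -> odd #|R|.
Proof.
move=> minM sMG abM expM defC nsR prR; have [/andP[_ nMG] _] := mingroupP minM.
have nCG : G \subset 'N(C) by rewrite defC normsI ?normG // norms_cent.
have [R2 | //] := even_prime prR.
have [y Ry ntR] : exists2 y, y \in R & y != 1.
  by apply/trivgPn; rewrite trivg_card1 R2.
have defR z : z \in R -> z != 1 -> z = y.
  move=> Rz ntz; apply/eqP; apply: contraTT isT => neq.
  have : (#|[set 1%g; y; z]| <= #|R|)%N.
    by apply: subset_leq_card; rewrite !subUset !sub1set group1 Ry Rz.
  by rewrite R2 -setUA cardsU1 cards2 !inE negb_or eq_sym ntR eq_sym ntz eq_sym neq.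
have [x Nx Gx def_y] := morphimP (subsetP (normal_sub nsR) y Ry).
have cosetC c : c \in G -> (c \in C) = (coset C c == 1).
  move=> Gc; apply/idP/eqP=> [/coset_id // | ].
  exact: (coset_idr (subsetP nCG c Gc)).
have Cx : x \in 'C(M).
  apply: (central_mod_cent_acts_trivially minM abM expM Gx).
    have Gx2 : x ^+ 2 \in G by rewrite groupX.
    suff : x ^+ 2 \in C by rewrite defC => /setIP[].
    rewrite cosetC // morphX //=; apply/eqP.
    by have := expg_cardG Ry; rewrite R2 def_y.
  move=> g Gg; have Gxg : [~ x, g] \in G by rewrite groupR.
  suff : [~ x, g] \in C by rewrite defC => /setIP[].
  have Ng := subsetP nCG g Gg.
  have : y ^ coset C g = y.
    apply: defR; last by rewrite conjg_eq1.
    by rewrite memJ_norm // (subsetP (normal_norm nsR)) // mem_quotient.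
  by rewrite cosetC // morphR //= def_y => /conjg_fixP.
by case/negP: ntR; rewrite def_y -cosetC // defC inE Gx.
Qed.

(** Let C be the centralizer of M. Summing over the cosets of C gives
    I(G) <= |C| (I(G / C) + 1) / 2, so I(G / C) + 1 >= 5/6 |G / C|, and the
    supersolvable group G / C has a normal subgroup of odd prime order; hence
    |G / C| = 6, I(G / C) = 4, and all the estimates are equalities. So C has
    exponent 2 and a lift of an involution of G / C fixes exactly half of C.
    Two such lifts fix together at least a quarter of C, they generate G modulo
    C, and the center of G is trivial; thus |C| <= 4. *)
Lemma two_minnormal_order24 gT (G M : {group gT}) :
  minnormal M G -> M \subset G -> abelian M -> {in M, forall m, m ^+ 2 = 1} ->
  ~~ cyclic M -> supersolvable (G / 'C_G(M)) -> 'Z(G) = 1 ->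
  (5 * #|G| <= 12 * #|sqrt1 G|)%N ->
  [/\ #|G| = 24%N, #|M| = 4%N & 'C_G(M) = M].
Proof.
move=> minM sMG abM expM ncycM ssQ Z1 many.
have [/andP[ntM nMG] Mmin] := mingroupP minM; have nsMG : M <| G by apply/andP.
pose C := 'C_G(M)%G; have defC : C :=: 'C_G(M) by [].
have sCG : C \subset G by apply: subsetIl.
have nCG : G \subset 'N(C) by rewrite defC normsI ?normG // norms_cent.
have nsCG : C <| G by apply/andP.
have ssH : supersolvable (G / C) by [].
have cardG : #|G| = (#|C| * #|G / C|)%N by rewrite card_quotient // Lagrange.
have sMC : M \subset C by rewrite defC subsetI sMG.
clearbody C => {ssQ}.
have ntH : G / C != 1.
  rewrite -subG1 quotient_sub1 // defC subsetI subxx /=.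
  by apply: contra ncycM => /(central_minnormal_cyclic minM).
have [R minR sRH] := minnormal_exists ntH (normG _).
have cycR := supersolvable_minnormal_cyclic ssH minR sRH.
have prR := cyclic_minnormal_prime minR cycR.
have nsRH : R <| G / C by have [/andP[_ nRH] _] := mingroupP minR; apply/andP.
have oddR := chief_over_cent_odd minM sMG abM expM defC nsRH prR.
have [le_all eq_all] := two_sqrt1_centralizer_quotient defC nsMG abM expM.
have [H6 I4] := odd_normal_sqrt1_order6 nsRH prR oddR
  (two_weight_quotient (cardG_gt0 C) le_all cardG many).
have /forall_inP eqJ : [forall x in G, 2 * #|coset_sqrt1 G C x| ==
               #|C| * ((coset C x \in sqrt1 (G / C)) + (x \in C))]%N.
  by rewrite -eq_all (two_weight_tight le_all cardG).
have expC c : c \in C -> c ^+ 2 = 1.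
  move=> Cc; have /eqP := eqJ 1 (group1 G).
  rewrite morph1 group1 (_ : 1 \in sqrt1 _) => [/=|]; last first.
    by apply/sqrt1P; rewrite group1 expg1n.
  rewrite mulnC => /eqP; rewrite eqn_pmul2r // => /eqP.
  case/(card_coset_sqrt1_full sCG)=> _ inv1; move: Cc; rewrite -{1}inv1.
  by case/invertedP=> _; rewrite conjg1 => cV; rewrite expgS expg1 {2}cV mulgV.
have abC : abelian C.
  apply/centsP=> c Cc d Cd.
  by apply: (@sqrt1_commute _ C); apply/sqrt1P; rewrite ?groupM ?expC ?groupM.
have lift u : u \in sqrt1 (G / C) -> u != 1 ->
    exists t, [/\ t \in G, coset C t = u & (2 * #|'C_C[t]| = #|C|)%N].
  move=> Iu ntu; have /sqrt1P[/morphimP[x Nx Gx def_u] _] := Iu.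
  have nCx : x \notin C.
    by apply: contra ntu => Cx; rewrite def_u /= coset_id.
  have /eqP := eqJ x Gx; rewrite -[coset C x]def_u Iu (negPf nCx) muln1 => eqJx.
  have [J0 | [c Jc]] := set_0Vmem (coset_sqrt1 G C x).
    by have := cardG_gt0 C; rewrite -eqJx J0 cards0.
  have [It eqI] := coset_sqrt1_rep sCG Jc; have /coset_sqrt1P[Cc Gt _] := Jc.
  exists (x * c); split=> //.
    rewrite morphM //=; last exact: (subsetP (normG C)).
    by rewrite (coset_id Cc) mulg1.
  rewrite -eqJx eqI; congr (2 * _)%N; apply: eq_card => d; rewrite [RHS]inE.
  rewrite inE; have [Cd | //] := boolP (d \in C) => /=.
  rewrite (sqrt1_invg (expC d Cd)).
  by apply/cent1P/eqP => [/commgP/conjg_fixP | /conjg_fixP/commgP].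
have [u1 [u2 [I1 nt1 I2 nt2 ne12]]] : exists u1, exists u2,
   [/\ u1 \in sqrt1 (G / C), u1 != 1, u2 \in sqrt1 (G / C), u2 != 1 & u2 != u1].
  have I_1 : 1 \in sqrt1 (G / C) by apply/sqrt1P; rewrite group1 expg1n.
  have := cardsD1 1 (sqrt1 (G / C)); rewrite I_1 I4 add1n => -[card3].
  have /card_gt0P[u1 D1] : (0 < #|sqrt1 (G / C) :\ 1%g|)%N by rewrite -card3.
  have := cardsD1 u1 (sqrt1 (G / C) :\ 1); rewrite D1 -card3 add1n => -[card2].
  have /card_gt0P[u2] : (0 < #|sqrt1 (G / C) :\ 1%g :\ u1|)%N by rewrite -card2.
  move: D1; rewrite 2!in_setD1 => /andP[nt1 I1]; rewrite in_setD1 => /and3P[ne nt2 I2].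
  by exists u1, u2.
have [t1 [Gt1 def_u1 half1]] := lift u1 I1 nt1.
have [t2 [Gt2 def_u2 half2]] := lift u2 I2 nt2.
pose Z := ('C_C[t1] :&: 'C_C[t2])%G.
have sZC : Z \subset C by rewrite subIset // subsetIl.
have Z_ge : (#|C| <= 4 * #|Z|)%N.
  (* |X| |Y| = |XY| |X :&: Y|, and the product set XY lies in C. *)
  have eq_prod : (#|'C_C[t1]| * #|'C_C[t2]| = #|('C_C[t1] * 'C_C[t2])%g| * #|Z|)%N.
    exact: mul_cardG.
  have le_prod : (#|('C_C[t1] * 'C_C[t2])%g| <= #|C|)%N.
    by rewrite subset_leq_card // mul_subG ?subsetIl.
  rewrite -(leq_pmul2l (cardG_gt0 C)).
  by clear -half1 half2 eq_prod le_prod; nia.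
have cZG : G \subset 'C(Z).
  have sCCZ : C \subset 'C_G(Z) by rewrite subsetI sCG (centsS sZC).
  have mem_t t : t \in G -> Z \subset 'C[t] -> t \in 'C_G(Z).
    by move=> Gt; rewrite sub_cent1 inE Gt.
  have CZ1 : t1 \in 'C_G(Z) by rewrite mem_t // subIset // subsetIr.
  have CZ2 : t2 \in 'C_G(Z) by rewrite mem_t // subIset // subsetIr orbT.
  suff : G / C \subset 'C_G(Z) / C.
    by rewrite quotientSGK // subsetI subxx.
  suff -> : 'C_G(Z) / C = G / C by [].
  apply: eq_of_lt_double; first by rewrite quotientS ?subsetIl.
  have Q1 : u1 \in 'C_G(Z) / C by rewrite -def_u1 mem_quotient.
  have Q2 : u2 \in 'C_G(Z) / C by rewrite -def_u2 mem_quotient.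
  have Q_ge3 : (2 < #|'C_G(Z) / C|)%N.
    have <- : #|[set (1 : coset_of C); u1; u2]| = 3.
      by rewrite -setUA cardsU1 cards2 !inE negb_or eq_sym nt1 eq_sym nt2 eq_sym ne12.
    by apply: subset_leq_card; rewrite !subUset !sub1set group1 Q1 Q2.
  (* An even number greater than 2 exceeds half of 6. *)
  have even_Q : (2 %| #|'C_G(Z) / C|)%N.
    have <- : #[u1] = 2%N.
      apply/eqP; rewrite eqn_leq order_gt1 nt1 order_sqrt1 andbT.
      by have /sqrt1P[_ ->] := I1.
    exact: order_dvdG.
  by rewrite H6; case/dvdnP: even_Q Q_ge3 => k ->; clear; lia.
have Z_1 : #|Z| = 1%N.
  apply/eqP; rewrite -trivg_card1 -subG1 -Z1 subsetI centsC cZG andbT.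
  exact: subset_trans sZC sCG.
have C_le4 : (#|C| <= 4)%N by rewrite Z_1 in Z_ge.
have defM : M :=: C.
  by apply/eqP; rewrite eqEcard sMC (leq_trans C_le4) // noncyclic_card_ge4.
have C4 : #|C| = 4.
  by apply/eqP; rewrite eqn_leq C_le4 -defM noncyclic_card_ge4.
by split; [rewrite cardG C4 H6 | rewrite defM | rewrite -defC].
Qed.

End TwoStruct.

(** * Recognizing the symmetric group of degree 4 *)

Section RecognizeS4.
Local Open Scope nat_scope.
Local Open Scope group_scope.

Section Embed.
Variables (gT : finGroupType) (T : finType) (to : {action gT &-> T}).
Variables (G : {group gT}) (S : {set T}) (x0 : T).
Hypotheses (Sx0 : x0 \in S) (actG : [acts G, on S | to]).

Definition index_action (g : gT) : {ffun 'I_#|S| -> 'I_#|S|} :=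
  [ffun i => enum_rank_in Sx0 (to (enum_val i) g)].

Lemma index_actionE g i : g \in G ->
  enum_val (index_action g i) = to (enum_val i) g.
Proof.
move=> Gg; rewrite ffunE enum_rankK_in //.
by rewrite (acts_act actG Gg) enum_valP.
Qed.

Lemma index_action_inj g : g \in G -> injectiveb (index_action g).
Proof.
move=> Gg; apply/injectiveP=> i j /(congr1 enum_val).
by rewrite !index_actionE // => /(act_inj to g)/enum_val_inj.
Qed.

(** Conversion of an action on S into one on the ordinals indexing S. The
    value 1 is a dummy taken outside G. *)
Definition index_perm (g : gT) : {perm 'I_#|S|} :=
  insubd (1 : {perm 'I_#|S|}) (index_action g).

Lemma index_permE g i : g \in G ->
  enum_val (index_perm g i) = to (enum_val i) g.
Proof.
move=> Gg; rewrite -index_actionE //; congr (enum_val _).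
by rewrite -pvalE insubdK //; apply: index_action_inj.
Qed.

Lemma index_permM : {in G &, {morph index_perm : g h / g * h}}.
Proof.
move=> g h Gg Gh; apply/permP=> i; apply: enum_val_inj.
by rewrite permM !index_permE ?groupM // actM.
Qed.

Canonical index_perm_morphism := Morphism index_permM.

Lemma injm_index_perm : 'C_G(S | to) = 1 -> 'injm index_perm.
Proof.
move=> faithful; apply/subsetP=> g /morphpreP[Gg /set1P g1].
rewrite -faithful inE Gg; apply/astabP=> x Sx.
have := index_permE (enum_rank_in Sx0 x) Gg.
by rewrite /= g1 perm1 enum_rankK_in.
Qed.

End Embed.

Lemma faithful_action_isog_S4 (gT : finGroupType) (T : finType)
    (to : {action gT &-> T}) (G : {group gT}) (S : {set T}) :
  #|G| = 24 -> #|S| = 4 -> [acts G, on S | to] -> 'C_G(S | to) = 1 ->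
  G \isog [set: 'S_4].
Proof.
move=> G24 S4 actG faithful.
have [x0 Sx0] : exists x0, x0 \in S by apply/card_gt0P; rewrite S4.
have injf := injm_index_perm Sx0 actG faithful.
suff : G \isog [set: 'S_#|S|] by rewrite S4.
apply/isogP; exists (index_perm_morphism Sx0 actG) => //.
apply/eqP; rewrite eqEcard subsetT card_injm // cardsT card_Sn.
by rewrite S4 G24.
Qed.

(** G acts by conjugation on its Sylow 3-subgroups. There are four of them,
    since a normal one would centralize M; the kernel of the action does not
    contain M, for the same reason, so it meets M trivially, centralizes it,
    and is trivial. *)
Lemma selfcentralizing4_isog_S4 (gT : finGroupType) (G M : {group gT}) :
  minnormal M G -> M \subset G -> #|G| = 24 -> #|M| = 4 -> 'C_G(M) = M ->
  G \isog [set: 'S_4].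
Proof.
move=> minM sMG G24 M4 defC; have [/andP[ntM nMG] Mmin] := mingroupP minM.
have cPM (P : {group gT}) : #|P| = 3 -> P \subset G -> M \subset 'N(P) -> False.
  move=> P3 sPG nPM; have tiPM : P :&: M = 1 by rewrite coprime_TIg // P3 M4.
  have : P \subset 'C_G(M).
    rewrite subsetI sPG; apply/commG1P/trivgP; rewrite -tiPM.
    by rewrite subsetI commg_subl commg_subr nPM (subset_trans sPG).
  by rewrite defC => /cardSg; rewrite P3 M4.
have cardP (P : {group gT}) : P \in 'Syl_3(G) -> #|P| = 3 /\ P \subset G.
  rewrite inE => sylP; split; last exact: pHall_sub sylP.
  by rewrite (card_Hall sylP) G24 p_part.
have card_syl : #|'Syl_3(G)| = 4.
  have := card_Syl_dvd 3 G; have := card_Syl_mod G (isT : prime 3).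
  have : #|'Syl_3(G)| != 1%N.
    apply/negP => /normal_sylowP[P sylP nsPG].
    have [P3 sPG] : #|P| = 3 /\ P \subset G by apply: cardP; rewrite inE.
    by apply: cPM P3 sPG (subset_trans sMG (normal_norm nsPG)).
  rewrite G24; move: (#|_|) => n.
  have [n_le | n_gt] := leqP n 24; last by move=> _ _ /(@dvdn_leq _ 24 isT); lia.
  by move: n n_le; do 25![case=> //].
have actG : [acts G, on 'Syl_3(G) | 'JG] by apply/atrans_acts/Syl_trans.
apply: (faithful_action_isog_S4 G24 card_syl actG).
pose K := 'C_G('Syl_3(G) | 'JG)%G; rewrite -[LHS]/(gval K).
have nKG : G \subset 'N(K).
  by rewrite normsI ?normG // (subset_trans actG) ?astab_norm.
have [tiKM | ntKM] := eqVneq (K :&: M) 1.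
  apply/trivgP; rewrite -tiKM subsetI subxx -defC subsetI subsetIl /=.
  apply/commG1P/trivgP; rewrite -tiKM subsetI commg_subl commg_subr.
  by rewrite (subset_trans sMG) // (subset_trans _ nMG) ?subsetIl.
have defKM : K :&: M = M.
  by apply: Mmin; rewrite ?subsetIr // ntKM normsI.
have [P sylP] : exists P, P \in 'Syl_3(G) by apply/card_gt0P; rewrite card_syl.
have [P3 sPG] := cardP P sylP; exfalso; apply: cPM P3 sPG _.
rewrite -defKM; apply/subsetP=> g /setIP[/setIP[_ /astabP/(_ P sylP) fixP] _].
by apply/normP; have /(congr1 val) := fixP.
Qed.

End RecognizeS4.

(** * Groups that are not supersolvable *)

Section NonSupersolvable.
Local Open Scope nat_scope.
Local Open Scope group_scope.

Lemma nonabelian_minnormal_sqrt1 (gT : finGroupType) (G M : {group gT}) :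
  minnormal M G -> M \subset G -> ~~ abelian M ->
  (12 * #|sqrt1 G| < 5 * #|G|)%N.
Proof.
move=> minM sMG nabM; have [/andP[_ nMG] _] := mingroupP minM.
have nsMG : M <| G by apply/andP.
rewrite -(ltn_pmul2l (cardG_gt0 M)) mulnCA -(sum_sqrt1_coset sMG) big_distrr /=.
have -> : (#|M| * (5 * #|G|) = \sum_(x in G) 5 * #|M|)%N.
  by rewrite sum_nat_const !(mulnCA _ 5) (mulnC #|M|).
have few x : x \in G -> (12 * #|coset_sqrt1 G M x| < 5 * #|M|)%N.
  exact: nonabelian_sqrt1_coset.
rewrite (bigD1 1) //= [X in (_ < X)%N](bigD1 1) //= -addSn leq_add ?few //.
by apply: leq_sum => x /andP[Gx _]; apply: ltnW; apply: few.
Qed.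

Lemma min_nonsupersolvable_S4 (gT : finGroupType) (G : {group gT}) :
  ~ supersolvable G ->
  (forall N : {group gT}, N <| G -> N :!=: 1 -> supersolvable (G / N)) ->
  (5 * #|G| <= 12 * #|sqrt1 G|)%N -> G \isog [set: 'S_4].
Proof.
move=> nssG ssQ many.
have ntG : G :!=: 1 by apply/eqP => /supersolvable_trivial.
have [M minM sMG] := minnormal_exists ntG (normG G).
have [/andP[ntM nMG] _] := mingroupP minM; have nsMG : M <| G by apply/andP.
have ncycM : ~~ cyclic M.
  apply/negP => cycM; apply: nssG.
  exact: (supersolvable_by_cyclic nsMG cycM (ssQ _ nsMG ntM)).
have [abM | nabM] := boolP (abelian M); last first.
  by have := nonabelian_minnormal_sqrt1 minM sMG nabM; rewrite ltnNge many.
have [_ _ /is_abelemP[p p_pr abelM]] :=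
  minnormal_solvable minM (subxx M) (abelian_sol abM).
have pM := abelem_pgroup abelM.
have [p2 | odd_p] := even_prime p_pr; last first.
  have oddM : odd #|M| by rewrite (card_pgroup pM) oddX odd_p orbT.
  by have := odd_minnormal_sqrt1 minM sMG abM oddM ncycM; rewrite ltnNge many.
have expM : {in M, forall m, m ^+ 2 = 1}.
  by move=> m Mm; rewrite -p2; have [_ ->] := abelemP p_pr abelM.
have nsC : 'C_G(M) <| G by rewrite /normal subsetIl normsI ?normG // norms_cent.
have ntC : 'C_G(M) != 1.
  by apply: contra ntM => /eqP C1; rewrite -subG1 -C1 subsetI sMG.
have [G24 M4 defC] := two_minnormal_order24 minM sMG abM expM ncycM
  (ssQ _ nsC ntC) (min_nonsupersolvable_center nssG ssQ) many.
exact: selfcentralizing4_isog_S4 minM sMG G24 M4 defC.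
Qed.

(** Induction over the quotients: if a proper quotient of G is not
    supersolvable, both alternatives lift from it to G. Otherwise G is minimal
    and is itself the symmetric group of degree 4 unless it has few square
    roots of 1. *)
Theorem nonsupersolvable_sqrt1 (gT : finGroupType) (G : {group gT}) :
  ~ supersolvable G ->
  (12 * #|sqrt1 G| < 5 * #|G|)%N \/
  (exists2 N : {group gT}, N <| G & G / N \isog [set: 'S_4]).
Proof.
have [n leGn] := ubnP #|G|; elim: n gT G leGn => // n IHn gT G leGn nssG.
have [few | many] := ltnP (12 * #|sqrt1 G|) (5 * #|G|); first by left.
pose bad (N : {group gT}) := [&& N <| G, N :!=: 1 &
   ~~ connect (cyclic_normal_step (G / N)) 1%G (G / N)%G].
have [N /and3P[nsNG ntN /supersolvableP nssQ] | ok] := pickP bad.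
  have ltQ : (#|G / N| < n)%N.
    by rewrite (leq_trans (ltn_quotient ntN (normal_sub nsNG))) // -ltnS.
  have [few | [L nsL isoL]] := IHn _ _ ltQ nssQ.
    have cardG : #|G| = (#|N| * #|G / N|)%N.
      by rewrite card_quotient ?normal_norm // Lagrange ?normal_sub.
    suff: (12 * #|sqrt1 G| < 5 * (#|N| * #|G / N|))%N by rewrite -cardG ltnNge many.
    have [le_I _] := sqrt1_quotient nsNG.
    apply: leq_ltn_trans (_ : 12 * (#|N| * #|sqrt1 (G / N)|) < _)%N.
      by rewrite leq_mul2l le_I orbT.
    by rewrite !(mulnCA _ #|N|) ltn_pmul2l.
  right; exists (coset N @*^-1 L)%G.
    by rewrite -(quotientGK nsNG) cosetpre_normal.
  have nsNL : N <| coset N @*^-1 L by rewrite /normal sub_cosetpre subsetIl.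
  have nsLG : coset N @*^-1 L <| G.
    by rewrite -(quotientGK nsNG) cosetpre_normal.
  apply: isog_trans isoL.
  have := third_isog (normal_sub nsNL) nsNG nsLG.
  by rewrite cosetpreK isog_sym.
right; exists 1%G; first exact: normal1.
apply: isog_trans (min_nonsupersolvable_S4 nssG _ many).
  by rewrite isog_sym quotient1_isog.
move=> N nsNG ntN; apply/supersolvableP.
by have := ok N; rewrite /bad nsNG ntN /= => /negbFE.
Qed.

End NonSupersolvable.

(** * Square roots of 1 in the symmetric group of degree 4 *)

Section S4.
Local Open Scope nat_scope.
Local Open Scope group_scope.

Lemma sqrt1_tperm (T : finType) (x y : T) : tperm x y \in sqrt1 [set: {perm T}].
Proof.
by apply/sqrt1P; rewrite inE expgS expg1 -{1}tpermV mulVg.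
Qed.

Lemma gen_sqrt1_perm (T : finType) : <<sqrt1 [set: {perm T}]>> = [set: {perm T}].
Proof.
apply/eqP; rewrite -subTset; apply/subsetP=> s _.
have [ts -> _] := prod_tpermP s; apply: group_prod => t _.
by rewrite mem_gen // sqrt1_tperm.
Qed.

(** If s has a cycle of length 3, it fixes the remaining point and has order
    3; otherwise all its cycles have length 1, 2 or 4. *)
Lemma S4_expg (s : 'S_4) : s ^+ 3 = 1 \/ s ^+ 4 = 1.
Proof.
have le4 y : #|porbit s y| <= 4.
  by rewrite -[X in _ <= X](card_ord 4) max_card.
have fix_mul k m y : iter k s y = y -> iter (m * k) s y = y.
  by move=> fix_y; elim: m => // m IHm; rewrite mulSn iterD IHm.
have [/existsP[x /eqP orb3] | no3] :=
    boolP [exists x, #|porbit s x| == 3]; [left | right].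
  apply/permP=> y; rewrite permX perm1.
  have [xy | nxy] := boolP (y \in porbit s x).
    have /eqP eq_xy : porbit s y == porbit s x by rewrite eq_porbit_mem.
    by have := iter_porbit s y; rewrite eq_xy orb3.
  have y1 : #|porbit s y| = 1%N.
    have : #|porbit s x :|: porbit s y| <= 4.
      by rewrite -[X in _ <= X](card_ord 4) max_card.
    rewrite cardsU (_ : _ :&: _ = set0) ?cards0 ?orb3; last first.
      apply/setP=> z; rewrite !inE; apply/negP => /andP[xz yz].
      case/negP: nxy; rewrite porbit_sym -eq_porbit_mem.
      by move: xz yz; rewrite -!eq_porbit_mem => /eqP <- /eqP ->.
    have := card_porbit_neq0 s y; lia.
  by apply: (fix_mul 1%N 3); have := iter_porbit s y; rewrite y1.
apply/permP=> y; rewrite permX perm1.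
have := iter_porbit s y; have := card_porbit_neq0 s y; have := le4 y.
move: no3; rewrite negb_exists => /forallP/(_ y).
case: #|porbit s y| => [|[|[|[|[|k]]]]] //= _ _ _ fix_y.
  exact: (fix_mul 1%N 4).
exact: (fix_mul 2 2).
Qed.

Let o0 : 'I_4 := @Ordinal 4 0 isT.
Let o1 : 'I_4 := @Ordinal 4 1 isT.
Let o2 : 'I_4 := @Ordinal 4 2 isT.
Let o3 : 'I_4 := @Ordinal 4 3 isT.

Lemma ord4P (P : 'I_4 -> Prop) : P o0 -> P o1 -> P o2 -> P o3 -> forall i, P i.
Proof.
move=> P0 P1 P2 P3 [[|[|[|[|//]]]] i4]; rewrite (bool_irrelevance i4 isT).
- exact: P0.
- exact: P1.
- exact: P2.
- exact: P3.
Qed.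

(** Generators a and b of a Sylow 2-subgroup, which is dihedral of order 8. *)
Lemma S4_dihedral : exists a b : 'S_4,
  [/\ a ^+ 2 = 1, b ^+ 2 = 1, (a * b) ^+ 2 != 1 & (a * b) ^+ 4 = 1].
Proof.
pose a := tperm o0 o1; pose b := tperm o0 o2 * tperm o1 o3.
have a2 : a ^+ 2 = 1 by have /sqrt1P[] := sqrt1_tperm o0 o1.
have b2 : b ^+ 2 = 1.
  by apply/permP; apply: ord4P; rewrite expgS expg1 /b !permM !permE /=.
have ab4 : (a * b) ^+ 4 = 1.
  by apply/permP; apply: ord4P; rewrite !expgS expg0 /a /b !permM !permE /=.
exists a, b; split=> //; apply/eqP=> /permP/(_ o0).
by rewrite expgS expg1 /a /b !permM !permE.
Qed.

(** The identity, the six transpositions and the three double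
    transpositions. *)
Lemma card_sqrt1_S4 : 10 <= #|sqrt1 [set: 'S_4]|.
Proof.
pose code (s : 'S_4) := [:: s o0; s o1; s o2; s o3].
pose l := [:: 1; tperm o0 o1; tperm o0 o2; tperm o0 o3; tperm o1 o2;
  tperm o1 o3; tperm o2 o3; tperm o0 o1 * tperm o2 o3;
  tperm o0 o2 * tperm o1 o3; tperm o0 o3 * tperm o1 o2].
have uniq_l : uniq l.
  by apply: (@map_uniq _ _ code); rewrite /= /code !permM !permE /=.
rewrite -[10]/(size l) cardE uniq_leq_size // => s.
have sq (t u : 'S_4) : t \in sqrt1 [set: 'S_4] -> u \in sqrt1 [set: 'S_4] ->
    commute t u -> t * u \in sqrt1 [set: 'S_4].
  move=> /sqrt1P[_ t2] /sqrt1P[_ u2] ctu; apply/sqrt1P.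
  by rewrite inE expgMn // t2 u2 mulg1.
rewrite mem_enum.
have I1 : (1 : 'S_4) \in sqrt1 [set: 'S_4] by apply/sqrt1P; rewrite inE expg1n.
do 7?[rewrite in_cons => /orP[/eqP -> | ]]; rewrite ?I1 ?sqrt1_tperm //.
rewrite 2!in_cons mem_seq1 => /or3P[] /eqP ->; apply: sq; rewrite ?sqrt1_tperm //;
  by apply/permP; apply: ord4P; rewrite !permM !permE.
Qed.

End S4.

(** * Direct products of an elementary abelian 2-group and the symmetric group *)

Section C2powS4.
Local Open Scope nat_scope.
Local Open Scope group_scope.

Lemma C2pow_expg2 n (a : C2pow n) : a ^+ 2 = 1.
Proof.
rewrite expgS expg1; apply/ffunP=> i; rewrite !ffunE.
by apply: val_inj; case: (a i) => [[|[|]]].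
Qed.

Lemma C2pow_abelem n : 2.-abelem [set: C2pow n].
Proof.
apply/abelemP=> //; split=> [|a _]; last exact: C2pow_expg2.
apply/centsP=> a _ b _; apply: (@sqrt1_commute _ setT);
  by apply/sqrt1P; rewrite inE C2pow_expg2.
Qed.

Lemma card_C2pow n : #|[set: C2pow n]| = (2 ^ n)%N.
Proof. by rewrite cardsT card_ffun !card_ord. Qed.

Lemma abelem2_isog_C2pow (gT : finGroupType) (N : {group gT}) :
  2.-abelem N -> exists n, N \isog [set: C2pow n].
Proof.
move=> abelN; exists (logn 2 #|N|).
rewrite (isog_abelem_card _ abelN) C2pow_abelem card_C2pow.
by rewrite -card_pgroup ?eqxx ?abelem_pgroup.
Qed.

Lemma expg_pair (aT bT : finGroupType) (a : aT) (b : bT) n :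
  ((a, b) ^+ n : aT * bT) = (a ^+ n, b ^+ n).
Proof. by elim: n => // n IHn; rewrite !expgS IHn. Qed.

(** Element orders divide 4 or 6. *)
Lemma totient_order_C2powS4 n (x : C2pow n * 'S_4) : (totient #[x] <= 2)%N.
Proof.
case: x => a b; have [b3 | b4] := S4_expg b.
  have : #[(a, b) : C2pow n * 'S_4] %| 6.
    rewrite order_dvdn expg_pair (expgM a 2 3) (expgM b 3 2).
    by rewrite C2pow_expg2 b3 !expg1n.
  move: (#[_]) => k k6; have := @dvdn_leq k 6 isT k6.
  by case: k k6 => [|[|[|[|[|[|[|k]]]]]]].
have : #[(a, b) : C2pow n * 'S_4] %| 4.
  rewrite order_dvdn expg_pair (expgM a 2 2).
  by rewrite C2pow_expg2 b4.
move: (#[_]) => k k4; have := @dvdn_leq k 4 isT k4.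
by case: k k4 => [|[|[|[|[|k]]]]].
Qed.

Lemma card_sqrt1_C2powS4 n :
  #|sqrt1 [set: C2pow n * 'S_4]| = (2 ^ n * #|sqrt1 [set: 'S_4]|)%N.
Proof.
rewrite -card_C2pow -cardsX; apply: eq_card => [[a b]].
rewrite in_setX in_setT /=; apply/sqrt1P/sqrt1P; rewrite !inE expg_pair.
  by case=> _ [].
by case=> _ ->; rewrite C2pow_expg2.
Qed.

Lemma num_cyclic_C2powS4 (gT : finGroupType) (G : {group gT}) n :
  G \isog [set: (C2pow n * 'S_4)%type] ->
  (num_cyclic G).*2 = (2 ^ n * (24 + #|sqrt1 [set: 'S_4]|))%N.
Proof.
move=> isoG; rewrite num_cyclic_eq.
  rewrite -(isog_sqrt1 isoG) card_sqrt1_C2powS4 (card_isog isoG) mulnDr.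
  by rewrite cardsT card_prod -cardsT card_C2pow card_Sn.
move=> x Gx; case/isogP: isoG => f injf _.
by rewrite -(order_injm injf Gx) totient_order_C2powS4.
Qed.

Lemma num_cyclic_S4 :
  (num_cyclic [set: 'S_4]%G).*2 = (24 + #|sqrt1 [set: 'S_4]|)%N.
Proof.
rewrite num_cyclic_eq; first by rewrite cardsT card_Sn.
move=> x _; have := totient_order_C2powS4 ((1, x) : C2pow 0 * 'S_4).
suff -> : #[(1, x) : C2pow 0 * 'S_4] = #[x] by [].
by apply: (order_injm (injm_pair1g _ _)); rewrite inE.
Qed.

End C2powS4.

(** * Splitting extensions with as many square roots of 1 as possible *)

Section Split.
Local Open Scope nat_scope.
Local Open Scope group_scope.

Lemma isog_gen_sqrt1 (gT rT : finGroupType) (G : {group gT}) (H : {group rT}) :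
  G \isog H -> <<sqrt1 G>> = G -> <<sqrt1 H>> = H.
Proof.
case/isogP=> f injf defH genG; apply/eqP; rewrite eqEsubset.
have sHH : sqrt1 H \subset H by apply/subsetP=> x /sqrt1P[].
have sGG : sqrt1 G \subset G by apply/subsetP=> x /sqrt1P[].
rewrite gen_subG sHH -{1}defH.
apply: (@subset_trans _ _ (f @* <<sqrt1 G>>)); first by rewrite genG.
rewrite morphim_gen // genS //.
apply/subsetP=> _ /morphimP[x Gx /sqrt1P[_ x2] ->]; apply/sqrt1P.
by rewrite -morphX // x2 morph1 -defH mem_morphim.
Qed.

(** The product ab is inverted by a, so the cyclic group it generates is
    normalized by a, and has index at most 2. *)
Lemma card_gen2_sqrt1 (gT : finGroupType) (a b : gT) :
  a ^+ 2 = 1 -> b ^+ 2 = 1 -> (#|<<[set a; b]>>| <= 2 * #[a * b])%N.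
Proof.
move=> a2 b2; have aV := sqrt1_invg a2; have bV := sqrt1_invg b2.
have nab : <[a]> \subset 'N(<[a * b]>).
  rewrite cycle_subG inE -cycleJ.
  have -> : (a * b) ^ a = (a * b)^-1.
    by rewrite conjgE invMg bV aV !mulgA -{1}aV mulVg mul1g.
  by rewrite cycleV.
have sub : <<[set a; b]>> \subset <[a]> * <[a * b]>.
  rewrite -norm_joinEl // gen_subG; apply/subsetP=> _ /set2P[] ->.
    by rewrite mem_gen // inE cycle_id.
  have {1}<- : a * (a * b) = b by rewrite -{1}aV mulKg.
  by apply: groupM; rewrite mem_gen // inE cycle_id ?orbT.
apply: leq_trans (subset_leq_card sub) _.
apply: (@leq_trans (#|<[a]>| * #|<[a * b]>|)); last first.
  by rewrite leq_mul2r -orderE order_sqrt1 a2 eqxx orbT.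
by rewrite mul_cardG leq_pmulr.
Qed.

(** If a were a power of ab, it would commute with b, and (ab)^2 would be 1. *)
Lemma card_gen2_sqrt1_ge (gT : finGroupType) (a b : gT) :
  a ^+ 2 = 1 -> b ^+ 2 = 1 -> (a * b) ^+ 2 != 1 ->
  (2 * #[a * b] <= #|<<[set a; b]>>|)%N.
Proof.
move=> a2 b2 nab2; apply: proper_double; rewrite properE; apply/andP; split.
  by rewrite cycle_subG groupM ?mem_gen ?set21 ?set22.
apply/subsetPn; exists a; first by rewrite mem_gen ?set21.
apply: contra nab2 => /cycleP[k def_a].
have cab : commute a (a * b).
  by rewrite {1}def_a; apply/commute_sym/commuteX.
have cab' : commute a b.
  by apply: (mulgI a); rewrite cab mulgA.
by rewrite expgMn // a2 b2 mulg1.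
Qed.

(** The group generated by a and b has order at most 8, and its image
    modulo N, where (ab)^2 survives, has order at least 8. *)
Lemma dihedral_lift (gT : finGroupType) (G N : {group gT}) (a b : gT) :
  N <| G -> a \in G -> b \in G -> a ^+ 2 = 1 -> b ^+ 2 = 1 ->
  (a * b) ^+ 2 \notin N -> (a * b) ^+ 4 = 1 ->
  #|<<[set a; b]>>| = 8 /\ N :&: <<[set a; b]>> = 1.
Proof.
move=> nsNG Ga Gb a2 b2 nab2 ab4; have nNG := normal_norm nsNG.
have [Na Nb] : a \in 'N(N) /\ b \in 'N(N) by split; apply: (subsetP nNG).
set K := <<_>>; have sKG : K \subset G by rewrite gen_subG subUset !sub1set Ga.
have K_le8 : (#|K| <= 8)%N.
  apply: leq_trans (card_gen2_sqrt1 a2 b2) _; rewrite (leq_mul2l 2 _ 4) /=.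
  by apply: dvdn_leq => //; rewrite order_dvdn ab4.
have Q_ge8 : (8 <= #|K / N|)%N.
  have a2' : (coset N a) ^+ 2 = 1 by rewrite -morphX // a2 morph1.
  have b2' : (coset N b) ^+ 2 = 1 by rewrite -morphX // b2 morph1.
  have abE k : (coset N a * coset N b) ^+ k = coset N ((a * b) ^+ k).
    by rewrite -morphM // -morphX ?groupM.
  have nab2' : (coset N a * coset N b) ^+ 2 != 1.
    apply: contra nab2; rewrite abE => /eqP/coset_idr; apply.
    by rewrite groupX ?groupM.
  have ord4 : #[coset N a * coset N b] = 4.
    have : #[coset N a * coset N b] %| 4 by rewrite order_dvdn abE ab4 morph1.
    move: nab2'; rewrite -order_dvdn; move: (#[_]) => k k2 k4.
    have := @dvdn_leq k 4 isT k4.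
    by move: k k4 k2; do 5![case=> //].
  rewrite -[8]/(2 * 4)%N -ord4.
  apply: leq_trans (card_gen2_sqrt1_ge a2' b2' nab2') _.
  rewrite subset_leq_card // gen_subG subUset !sub1set.
  by rewrite !mem_quotient // mem_gen ?set21 ?set22.
have cardK : (#|K :&: N| * #|K / N| = #|K|)%N.
  rewrite -(LagrangeI [group of K] N) card_quotient //.
  exact: subset_trans sKG nNG.
have KN1 : #|K :&: N| = 1%N.
  apply/eqP; rewrite eqn_leq (cardG_gt0 [group of K :&: N]) andbT.
  rewrite -(@leq_pmul2r 8) // mul1n (leq_trans _ K_le8) // -cardK.
  by rewrite leq_mul2l Q_ge8 orbT.
split; first by apply/eqP; rewrite eqn_leq K_le8 -cardK KN1 mul1n.
by rewrite setIC; apply/eqP; rewrite trivg_card1 KN1.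
Qed.

(** Equality in [sqrt1_quotient] says that every lift of a square root of 1
    is one. So N has exponent 2 and commutes with all such lifts, which generate
    G modulo N since transpositions generate the quotient: N is central. Lifts
    of two dihedral generators have a product whose square is again a lift of a
    square root of 1, so they generate a subgroup of order 8 that meets N
    trivially. Hence N has a complement in a Sylow 2-subgroup and, by a theorem
    of Gaschuetz, in G. *)
Lemma S4_extension_split (gT : finGroupType) (G N : {group gT}) :
  N <| G -> G / N \isog [set: 'S_4] ->
  #|sqrt1 G| = (#|N| * #|sqrt1 (G / N)|)%N ->
  exists n, G \isog [set: (C2pow n * 'S_4)%type].
Proof.
move=> nsNG isoQ eqI; have nNG := normal_norm nsNG; have sNG := normal_sub nsNG.
have allI x : x \in G -> coset N x \in sqrt1 (G / N) -> x ^+ 2 = 1.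
  have [_] := sqrt1_quotient nsNG; rewrite eqI eqxx => /esym/forall_inP all2.
  by move=> Gx Ix; apply/eqP/(implyP (all2 x Gx)).
have IQ1 : 1 \in sqrt1 (G / N) by apply/sqrt1P; rewrite group1 expg1n.
have expN n : n \in N -> n ^+ 2 = 1.
  by move=> Nn; apply: allI; rewrite ?(subsetP sNG) // coset_id.
have abN : abelian N.
  apply/centsP=> m Mm n Nn; apply: (@sqrt1_commute _ N);
    by apply/sqrt1P; rewrite ?groupM ?expN ?groupM.
have abelN : 2.-abelem N by apply/abelemP.
have cNG : G \subset 'C(N).
  have sNC : N \subset 'C_G(N) by rewrite subsetI sNG; apply: abN.
  suff : G / N \subset 'C_G(N) / N.
    by rewrite quotientSGK // => sGC; apply: subset_trans sGC (subsetIr _ _).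
  have genQ : <<sqrt1 (G / N)>> = G / N.
    have isoS4 : [set: 'S_4]%G \isog (G / N)%G by rewrite isog_sym.
    exact: isog_gen_sqrt1 isoS4 (gen_sqrt1_perm _).
  rewrite -{1}genQ gen_subG; apply/subsetP=> u Iu.
  have /sqrt1P[/morphimP[x Nx Gx def_u] _] := Iu.
  rewrite def_u mem_quotient // inE Gx /=; apply/centP=> n Nn.
  have Gn := subsetP sNG n Nn.
  have coset_xn : coset N (x * n) = coset N x.
    rewrite morphM //=; last exact: (subsetP (normG N)).
    by rewrite (coset_id Nn) mulg1.
  rewrite def_u /= in Iu.
  have Ixn : x * n \in sqrt1 G.
    by apply/sqrt1P; split; [|apply: allI; rewrite ?coset_xn //]; rewrite groupM.
  have Ix : x \in sqrt1 G by apply/sqrt1P; rewrite (allI x).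
  have In : n \in sqrt1 G by apply/sqrt1P; rewrite expN.
  exact: sqrt1_commute Ix In Ixn.
have isoS4 : [set: 'S_4] \isog G / N by rewrite isog_sym.
have [f injf def_f] := isogP isoS4.
have [a' [b' [a2 b2 ab2 ab4]]] := S4_dihedral.
have fQ s : f s \in G / N by rewrite -def_f mem_morphim ?inE.
have lift s : exists2 x, x \in G & coset N x = f s.
  by have /morphimP[x Nx Gx ->] := fQ s; exists x.
have [a Ga fa] := lift a'; have [b Gb fb] := lift b'.
have fX s k : f s ^+ k = f (s ^+ k) by rewrite morphX ?inE.
have sqI x s : x \in G -> coset N x = f s -> s ^+ 2 = 1 -> x ^+ 2 = 1.
  move=> Gx fx s2; apply: allI => //; apply/sqrt1P.
  by rewrite fx fQ fX s2 morph1.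
have fab : coset N (a * b) = f (a' * b').
  by rewrite morphM ?(subsetP nNG) //= fa fb morphM ?inE.
have fab2 : coset N ((a * b) ^+ 2) = f ((a' * b') ^+ 2).
  by rewrite morphX ?(subsetP nNG) ?groupM //= fab fX.
have [K8 tiNK] : #|<<[set a; b]>>| = 8 /\ N :&: <<[set a; b]>> = 1.
  apply: (dihedral_lift nsNG) => //; first exact: sqI fa a2.
  - exact: sqI fb b2.
  - apply: contra ab2 => /coset_id; rewrite fab2 => /eqP.
    by rewrite morph_injm_eq1 ?inE.
  rewrite (expgM _ 2 2); apply: sqI fab2 _; first by rewrite groupX ?groupM.
  by rewrite -expgM.
set K := [group of <<[set a; b]>>].
have sKG : K \subset G by rewrite gen_subG subUset !sub1set Ga.
have cardG : #|G| = (24 * #|N|)%N.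
  by rewrite -(Lagrange sNG) -card_quotient // (card_isog isoQ) cardsT card_Sn mulnC.
pose P := (N <*> K)%G; have sPG : P \subset G by rewrite join_subG sNG.
have defP : P :=: N * K by rewrite /= norm_joinEr // (subset_trans sKG).
have cardP : #|P| = (8 * #|N|)%N.
  by rewrite defP TI_cardMg // mulnC K8.
have indexP : #|G : P| = 3.
  apply/eqP; rewrite -(eqn_pmul2l (cardG_gt0 P)) Lagrange // cardG cardP.
  by rewrite mulnAC.
have coP : coprime #|N| #|G : P|.
  rewrite indexP (card_pgroup (abelem_pgroup abelN)).
  by rewrite coprimeXl.
have : [splits G, over N].
  rewrite (Gaschutz_split nsNG (joing_subl _ _) sPG abN coP).
  by apply/splitsP; exists K; apply/complP.
case/splitsP=> L /complP[tiNL defG].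
have sLG : L \subset G by rewrite -defG mulG_subr.
have isoL : L \isog [set: 'S_4].
  have defQ : L / N = G / N by rewrite -defG quotientMidl.
  have := quotient_isog (subset_trans sLG nNG) tiNL.
  by rewrite defQ => isoLQ; apply: isog_trans isoLQ isoQ.
have [n isoN] := abelem2_isog_C2pow abelN; exists n.
have defGx : N \x L = G by rewrite dprodE // (subset_trans sLG).
have defX : setX [set: C2pow n] 1 \x setX 1 [set: 'S_4]
    = setX [set: C2pow n] [set: 'S_4].
  exact: setX_dprod.
have -> : [set: C2pow n * 'S_4] = setX [set: C2pow n] [set: 'S_4].
  by apply/setP=> x; rewrite !inE.
apply: (isog_dprod defGx defX).
  exact: isog_trans isoN (isog_setX1 _ _).
exact: isog_trans isoL (isog_set1X _ _).
Qed.

End Split.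

(** * The bound and the case of equality *)

Section Alpha.

Lemma alpha_le_cross (gT rT : finGroupType) (G : {group gT}) (H : {group rT}) :
  (alpha G <= alpha H) = (num_cyclic G * #|H| <= num_cyclic H * #|G|)%N.
Proof.
have pos (hT : finGroupType) (K : {group hT}) : 0 < #|K|%:R :> rat.
  by rewrite ltr0n cardG_gt0.
by rewrite /alpha ler_pdivrMr // mulrAC ler_pdivlMr // -!natrM ler_nat.
Qed.

Lemma alpha_eq_cross (gT rT : finGroupType) (G : {group gT}) (H : {group rT}) :
  alpha G = alpha H <-> (num_cyclic G * #|H| = num_cyclic H * #|G|)%N.
Proof.
split=> [/eqP | eqc].
  by rewrite eq_le !alpha_le_cross => /andP[le1 le2]; apply/eqP; rewrite eqn_leq le1.
by apply/eqP; rewrite eq_le !alpha_le_cross eqc leqnn.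
Qed.

End Alpha.

Section AlphaArith.
Local Open Scope nat_scope.

(** In these lemmas c and c4 are the numbers of cyclic subgroups of G and
    of the symmetric group of degree 4, i and i4 their numbers of square roots
    of 1, and g the order of G. *)
Lemma cross_lt_of_few c c4 g i i4 : c.*2 <= g + i -> c4.*2 = 24 + i4 -> 10 <= i4 ->
  12 * i < 5 * g -> c * 24 < c4 * g.
Proof.
move=> cg c4E i10 few; rewrite -ltn_double -!muln2.
by rewrite mulnAC muln2 [X in _ < X]mulnAC muln2 c4E; nia.
Qed.

Lemma cross_of_quotient c c4 g i i4 n : c.*2 <= g + i -> c4.*2 = 24 + i4 ->
  g = 24 * n -> i <= n * i4 ->
  c * 24 <= c4 * g /\ (c * 24 = c4 * g -> i = n * i4).
Proof.
move=> cg c4E gE ile; split=> [|eq].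
  rewrite -leq_double -!muln2 mulnAC muln2 [X in _ <= X]mulnAC muln2 c4E; nia.
apply/eqP; rewrite eqn_leq ile /=.
have : c.*2 * 24 = (24 + i4) * g by rewrite -c4E -!muln2 mulnAC eq mulnAC.
nia.
Qed.

Lemma cross_of_product c c4 g i4 p : c.*2 = p * (24 + i4) -> c4.*2 = 24 + i4 ->
  g = p * 24 -> c * 24 = c4 * g.
Proof.
move=> cE c4E ->; have -> : c = p * c4; last by rewrite mulnCA mulnA.
by apply: double_inj; rewrite cE -c4E doubleMr.
Qed.

End AlphaArith.

Theorem theorem6 (gT : finGroupType) (G : {group gT}) :
  ~ supersolvable G ->
  alpha G <= alpha [set: 'S_4]%G /\
  (alpha G = alpha [set: 'S_4]%G <->
   exists n : nat, G \isog [set: (C2pow n * 'S_4)%type]%G).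
Proof.
move=> nssG; rewrite alpha_le_cross alpha_eq_cross /=.
have S4_24 : #|[set: 'S_4]%G| = 24%N by rewrite cardsT card_Sn.
rewrite S4_24.
have cG := num_cyclic_le G; have cS4 := num_cyclic_S4.
have conv : (exists n : nat, G \isog [set: (C2pow n * 'S_4)%type]%G) ->
    (num_cyclic G * 24 = num_cyclic [set: 'S_4]%G * #|G|)%N.
  case=> n isoG; have c2 := num_cyclic_C2powS4 isoG.
  have gE : #|G| = (2 ^ n * 24)%N.
    by rewrite (card_isog isoG) cardsT card_prod -cardsT card_C2pow card_Sn.
  exact: cross_of_product c2 cS4 gE.
case: (nonsupersolvable_sqrt1 nssG) => [few | [N nsNG isoQ]].
  have lt_c := cross_lt_of_few cG cS4 card_sqrt1_S4 few.
  split; first exact: ltnW.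
  split=> [eq_c|]; last exact: conv.
  by rewrite eq_c ltnn in lt_c.
have gE : #|G| = (24 * #|N|)%N.
  rewrite -(Lagrange (normal_sub nsNG)) -card_quotient ?normal_norm //.
  by rewrite (card_isog isoQ) S4_24 mulnC.
have [le_I _] := sqrt1_quotient nsNG.
rewrite (isog_sqrt1 isoQ) in cS4.
have [le_c eq_c] := cross_of_quotient cG cS4 gE le_I.
split=> //; split=> [/eq_c eqI|]; last exact: conv.
exact: S4_extension_split nsNG isoQ eqI.
Qed.
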